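(* Let $0\le i\le n-1$. Assume $e\in\mathrm{Core}(i)$ and let $\mathcal{A}$ be the minimal affine space containing both $e$ and $\mathrm{Opt}$. Then $$\mathcal{A}\cap\Lambda_{++}\subseteq\mathrm{Core}(i).$$
   Context: $\mathcal{E}$ is a finite-dimensional Euclidean space. $p:\mathcal{E}\to\mathbb{R}$ is a homogeneous polynomial of degree $n$ that is hyperbolic in some direction $e_0$: $p(e_0)>0$ and for every $x$ all roots of $t\mapsto p(x+te_0)$ are real. $\Lambda_{++}$ is the connected component of $\{p>0\}$ containing $e_0$, and $\Lambda_+$ is its closure. Known (Gårding): $\Lambda_{++}$ is convex and $p$ is hyperbolic in every direction $e\in\Lambda_{++}$. For $e\in\Lambda_{++}$ and $0\le i\le n-1$, $p_e^{(i)}(x):=D^ip(x)[e,\dots,e]$ ($i$ copies of $e$; $p_e^{(0)}=p$), which is hyperbolic in direction $e$ of degree $n-i$; $\Lambda^{(i)}_{++,e}$ is the connected component of $\{p_e^{(i)}>0\}$ containing $e$, and $\Lambda^{(i)}_{+,e}$ its closure. Standing assumptions: $\Lambda_+$ is regular (nonempty interior, contains no linear subspace other than $\{0\}$); $A:\mathcal{E}\to\mathbb{R}^m$ is linear and surjective; $0\ne b\in\mathbb{R}^m$; $c^*$ is a linear functional on $\mathcal{E}$ not in the image of $A^*$ (i.e. not of the form $y^*A$). HP is the problem of minimizing $c^*x$ subject to $Ax=b$, $x\in\Lambda_+$; $\mathrm{Opt}$ is its set of optimal solutions. $\mathrm{HP}^{(i)}_e$ is the problem of minimizing $c^*x$ subject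 to $Ax=b$, $x\in\Lambda^{(i)}_{+,e}$, and $\mathrm{Opt}^{(i)}_e$ is its set of optimal solutions. For $0\le i\le n-1$, $\mathrm{Swath}(i):=\{e\in\Lambda_{++}: Ae=b,\ \mathrm{Opt}^{(i)}_e\ne\emptyset\}$ and $\mathrm{Core}(i):=\{e\in\mathrm{Swath}(i):\mathrm{Opt}^{(i)}_e=\mathrm{Opt}\}$. *)

(* Defs.v *)
From HB Require Import structures.
From mathcomp Require Import all_boot all_order all_algebra.
From mathcomp Require Import all_classical all_reals all_analysis.
(* The notations of [complex] and [mpoly] clash with those of the analysis
   library. *)
From mathcomp Require Import -(notations) complex mpoly.

Set Implicit Arguments.
Unset Strict Implicit.
Unset Printing Implicit Defensive.

Import Order.TTheory GRing.Theory Num.Theory.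
Import numFieldNormedType.Exports.

Local Open Scope classical_set_scope.
Local Open Scope ring_scope.

(* The Euclidean space is ['rV[R]_d], in orthonormal coordinates; the inner
   product intervenes only through the topology. *)

Section HyperbolicPolynomials.
Context {R : realType} {d : nat}.
Implicit Types (q : mpoly d R) (x e : 'rV[R]_d).

Definition is_homogeneous (k : nat) q : Prop :=
  q \is ishomog1 k (@mdeg d).

Definition evalp q x : R := meval (x 0) q.

(* q(x + t e) for a complex scalar t *)
Definition evalp_line q x e (t : complex R) : complex R :=
  meval
    (fun j => real_complex R (x 0 j) + t * real_complex R (e 0 j))
    (map_mpoly (real_complex R) q).

Definition hyperbolic q e : Prop :=
  0 < evalp q e /\
  forall x (t : complex R),
    evalp_line q x e t = 0 -> complex.Im t = 0.

Definition open_cone q e : set 'rV[R]_d :=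
  connected_component [set x | 0 < evalp q x] e.

Definition closed_cone q e : set 'rV[R]_d := closure (open_cone q e).

Definition dirderiv e q : mpoly d R :=
  \sum_(j < d) e 0 j *: mderiv j q.

(* The polynomial x |-> D^i q(x)[e, ..., e]; [iter_derive_evalp] below identifies
   its values with the iterated directional derivatives ['D_e] of x |-> q(x). *)
Definition dirderivn (i : nat) e q : mpoly d R := iter i (dirderiv e) q.

Lemma dirderivD e q1 q2 : dirderiv e (q1 + q2) = dirderiv e q1 + dirderiv e q2.
Proof.
by rewrite /dirderiv -big_split; apply: eq_bigr => j _; rewrite mderivD scalerDr.
Qed.

Lemma dirderivZ e a q : dirderiv e (a *: q) = a *: dirderiv e q.
Proof.
rewrite /dirderiv scaler_sumr; apply: eq_bigr => j _.
by rewrite mderivZ !scalerA mulrC.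
Qed.

Lemma dirderivM e q1 q2 :
  dirderiv e (q1 * q2) = dirderiv e q1 * q2 + q1 * dirderiv e q2.
Proof.
rewrite /dirderiv mulr_suml mulr_sumr -big_split; apply: eq_bigr => j _ /=.
by rewrite mderivM scalerDr scalerAl scalerAr.
Qed.

Lemma is_derive_evalp q x e :
  is_derive x e (evalp q) (evalp (dirderiv e q) x).
Proof.
have D0 r : is_derive x e (evalp (mpolyC d r))
    (evalp (dirderiv e (mpolyC d r)) x).
  have -> : evalp (mpolyC d r) = cst r.
    by apply/funext => y; rewrite /evalp mevalC.
  rewrite /dirderiv big1 ?/evalp ?meval0 => [|j _].
    exact: is_derive_cst.
  by rewrite mderivC scaler0.
have DZ a q1 : is_derive x e (evalp q1) (evalp (dirderiv e q1) x) ->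
    is_derive x e (evalp (a *: q1)) (evalp (dirderiv e (a *: q1)) x).
  move=> h; have -> : evalp (a *: q1) = a \*: evalp q1.
    by apply/funext => y; rewrite /evalp mevalZ.
  by rewrite dirderivZ /evalp mevalZ; exact: is_deriveZ.
have DD q1 q2 : is_derive x e (evalp q1) (evalp (dirderiv e q1) x) ->
    is_derive x e (evalp q2) (evalp (dirderiv e q2) x) ->
    is_derive x e (evalp (q1 + q2)) (evalp (dirderiv e (q1 + q2)) x).
  move=> h1 h2; have -> : evalp (q1 + q2) = evalp q1 + evalp q2.
    by apply/funext => y; rewrite /evalp mevalD.
  by rewrite dirderivD /evalp mevalD; exact: is_deriveD.
have DM q1 q2 : is_derive x e (evalp q1) (evalp (dirderiv e q1) x) ->
    is_derive x e (evalp q2) (evalp (dirderiv e q2) x) ->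
    is_derive x e (evalp (q1 * q2)) (evalp (dirderiv e (q1 * q2)) x).
  move=> h1 h2; have -> : evalp (q1 * q2) = evalp q1 * evalp q2.
    by apply/funext => y; rewrite /evalp mevalM.
  rewrite dirderivM /evalp mevalD !mevalM addrC.
  rewrite [X in _ + X]mulrC; exact: is_deriveM.
have DX j : is_derive x e (evalp (mpolyX R (mnm1 j)))
    (evalp (dirderiv e (mpolyX R (mnm1 j))) x).
  have -> : evalp (mpolyX R (mnm1 j)) = (fun y => y 0 j).
    by apply/funext => y; rewrite /evalp mevalXU.
  have -> : evalp (dirderiv e (mpolyX R (mnm1 j))) x = e 0 j.
    rewrite /dirderiv (bigD1 j) //= big1 => [|k kj]; last first.
      by rewrite mderivX mnm1E eq_sym (negbTE kj) scale0r scaler0.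
    rewrite addr0 mderivX mnm1E eqxx scale1r.
    have -> : mnm_sub (mnm1 j) (mnm1 j) = mnm0.
      by apply/mnmP => k; rewrite mnmBE subnn mnm0E.
    rewrite mpolyX0.
    by rewrite /evalp mevalZ meval1 mulr1.
  have dc : differentiable (fun y : 'rV[R]_d => y 0 j) x.
    exact: differentiable_coord.
  apply: DeriveDef; first exact: diff_derivable.
  rewrite deriveE //.
  have @f : {linear 'rV[R]_d -> R}.
    by exists (fun N : 'rV[R]_d => N 0 j); do 2![eexists]; do ?[constructor];
       rewrite ?mxE// => ? *; rewrite ?mxE//; move=> ?; rewrite !mxE.
  rewrite (_ : (fun _ => _) = f) // diff_lin //; exact: coord_continuous.
elim/mpolyind: q => [|a m q _ _ IH].
  by rewrite -(mpolyC0 d R).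
apply: (DD) => //; apply: (DZ).
rewrite mpolyXE_id.
have D1 := D0 1; rewrite mpolyC1 in D1.
apply: (big_ind (fun r => is_derive x e (evalp r) (evalp (dirderiv e r) x))) => //.
move=> j _; elim: (m j) => [|k IHk]; first by rewrite expr0.
by rewrite exprS; exact: (DM).
Qed.

Lemma iter_derive_evalp i e q :
  iter i (fun (f : 'rV[R]_d -> R) x => 'D_e f x) (evalp q) =
  evalp (dirderivn i e q).
Proof.
elim: i => //= i ->; apply/funext => x.
by have [_ ->] := is_derive_evalp (dirderivn i e q) x e.
Qed.

End HyperbolicPolynomials.

Section HyperbolicPrograms.
Context {R : realType} {d m : nat}.
Local Notation E := 'rV[R]_d.
Implicit Types (p : mpoly d R) (e : E) (K S : set E).

Definition regular_cone K : Prop :=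
  interior K !=set0 /\
  forall V : {vspace E}, [set x | x \in V] `<=` K -> V = 0%VS.

Implicit Types (A : {linear E -> 'rV[R]_m}) (b : 'rV[R]_m) (c : {scalar E}).

Definition feasible A b K : set E := [set x | A x = b /\ K x].

Definition Opt A b c K : set E :=
  [set x | feasible A b K x /\ forall y, feasible A b K y -> c x <= c y].

Definition Swath p (e0 : E) A b c (i : nat) : set E :=
  [set e | [/\ open_cone p e0 e, A e = b &
    Opt A b c (closed_cone (dirderivn i e p) e) !=set0]].

Definition Core p (e0 : E) A b c (i : nat) : set E :=
  [set e | Swath p e0 A b c i e /\
    Opt A b c (closed_cone (dirderivn i e p) e) =
    Opt A b c (closed_cone p e0)].

Definition affine_subspace S : Prop :=
  exists (a : E) (V : {vspace E}), S = [set x | x - a \in V].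

(* An intersection of affine subspaces; itself one as soon as S is nonempty. *)
Definition affine_hull S : set E := smallest affine_subspace S.

End HyperbolicPrograms.

(* Main.v *)
Require Import Defs.
From HB Require Import structures.
From mathcomp Require Import all_boot all_order all_algebra.
From mathcomp Require Import all_classical all_reals all_analysis.
From mathcomp Require Import -(notations) complex mpoly.
From mathcomp Require Import ring lra zify.

Import Order.TTheory GRing.Theory Num.Theory.
Import numFieldNormedType.Exports.

Set Implicit Arguments.
Unset Strict Implicit.
Unset Printing Implicit Defensive.

Local Open Scope classical_set_scope.
Local Open Scope ring_scope.

(* The cones are described by derivatives: the hyperbolicity cone of P in the
   direction e is the set of x such that all D_e^j P(x) are positive, and its
   closure is obtained by relaxing the signs. Mixed derivatives of P along
   directions of the closed cone are nonnegative on it, so such a derivative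
   vanishes identically as soon as it vanishes at one interior point.

   Choose z in Opt and l maximal with K := D_z^l p <> 0. Then D_z' K = 0 for all
   z' in Opt, hence if e' is in the affine hull, D_e' K is a positive multiple of
   D_e K. As D_z^l is the leading part at z, the relaxations for e and e' have
   the same tangent directions at z, and z remains optimal for e'.

   If y is optimal for e', then D_e'^i p vanishes on the segment [z, y]. If
   D_e' P vanishes on [z, y] for P = D_e'^j p, then so does P: at a point where
   P <> 0 the function D_z P / P, which maps the upper half of the line in
   direction e' to the lower half-plane, has zero derivative, so it is
   constant and D_z P = 0; this forces D_z p = 0, which is impossible because
   the cone is regular and A z = b <> 0. Descending to j = 0 puts y in the
   original cone. *)

(** * Restrictions of polynomials to lines *)

Section Lines.
Context {F : numFieldType} {d : nat}.
Implicit Types (q : mpoly d F) (x y : 'rV[F]_d) (t : F).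

(** The map t |-> q(x + t y) is stored as a univariate polynomial, so that its coefficients, roots
    and size are at hand over the reals as well as over the complex numbers. *)
Definition line q x y : {poly F} :=
  mmap (@polyC F) (fun j => (x 0 j)%:P + y 0 j *: 'X) q.

Lemma horner_line q x y t : (line q x y).[t] = meval ((x + t *: y) 0) q.
Proof.
rewrite /line mevalE horner_sum; apply: eq_bigr => m _.
rewrite hornerM hornerC /mmap1 horner_prod; congr (_ * _).
apply: eq_bigr => j _; rewrite horner_exp !hornerE !mxE.
by rewrite (mulrC (y 0 j)).
Qed.

(** The value at 0 is left out because [line_rev] inverts t. The points 1, 2, 3, ... provide enough
    roots of [f - g]. *)
Lemma poly_eq_nonzero (f g : {poly F}) :
  (forall t, t != 0 -> f.[t] = g.[t]) -> f = g.
Proof.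
move=> fg; apply/eqP; rewrite -subr_eq0; apply/eqP.
pose s := [seq (k.+1)%:R : F | k <- iota 0 (size (f - g))].
apply: (@roots_geq_poly_eq0 _ _ s); last by rewrite size_map size_iota.
  by apply/allP => _ /mapP[k _ ->]; rewrite rootE !hornerE fg ?subrr.
rewrite map_inj_uniq ?iota_uniq// => i j /eqP.
by rewrite eqr_nat => /eqP[].
Qed.

Lemma poly_eq_fun (f g : {poly F}) : (forall t, f.[t] = g.[t]) -> f = g.
Proof. by move=> fg; apply: poly_eq_nonzero => t _. Qed.

Lemma lineD q1 q2 x y : line (q1 + q2) x y = line q1 x y + line q2 x y.
Proof. by apply: poly_eq_fun => t; rewrite hornerD !horner_line mevalD. Qed.

Lemma lineZ a q x y : line (a *: q) x y = a *: line q x y.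
Proof. by apply: poly_eq_fun => t; rewrite hornerZ !horner_line mevalZ. Qed.

Lemma lineM q1 q2 x y : line (q1 * q2) x y = line q1 x y * line q2 x y.
Proof. by apply: poly_eq_fun => t; rewrite hornerM !horner_line mevalM. Qed.

(** This is [dirderiv] over any numeric field, for use on complexified polynomials; over the reals
    the two are convertible. *)
Definition ddir y q : mpoly d F := \sum_(j < d) y 0 j *: mderiv j q.

Lemma ddirD y q1 q2 : ddir y (q1 + q2) = ddir y q1 + ddir y q2.
Proof.
by rewrite /ddir -big_split; apply: eq_bigr => j _; rewrite mderivD scalerDr.
Qed.

Lemma ddirZ y a q : ddir y (a *: q) = a *: ddir y q.
Proof.
rewrite /ddir scaler_sumr; apply: eq_bigr => j _.
by rewrite mderivZ !scalerA mulrC.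
Qed.

Lemma ddirM y q1 q2 : ddir y (q1 * q2) = ddir y q1 * q2 + q1 * ddir y q2.
Proof.
rewrite /ddir mulr_suml mulr_sumr -big_split; apply: eq_bigr => j _ /=.
by rewrite mderivM scalerDr scalerAl scalerAr.
Qed.

Lemma ddirC y a : ddir y (mpolyC d a) = 0.
Proof. by rewrite /ddir big1// => j _; rewrite mderivC scaler0. Qed.

Lemma ddirDl y1 y2 q : ddir (y1 + y2) q = ddir y1 q + ddir y2 q.
Proof.
by rewrite /ddir -big_split; apply: eq_bigr => j _; rewrite mxE scalerDl.
Qed.

Lemma ddirZl a y q : ddir (a *: y) q = a *: ddir y q.
Proof.
by rewrite /ddir scaler_sumr; apply: eq_bigr => j _; rewrite mxE scalerA.
Qed.

Lemma ddir_comm y1 y2 q : ddir y1 (ddir y2 q) = ddir y2 (ddir y1 q).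
Proof.
have aux a b : ddir a (ddir b q) =
    \sum_(i < d) \sum_(j < d) (a 0 i * b 0 j) *: mderiv i (mderiv j q).
  rewrite {1}/ddir; apply: eq_bigr => i _.
  rewrite /ddir [mderiv i _]raddf_sum scaler_sumr; apply: eq_bigr => j _.
  by rewrite /= mderivZ scalerA.
rewrite !aux exchange_big /=; apply: eq_bigr => i _; apply: eq_bigr => j _.
by rewrite mderiv_comm mulrC.
Qed.

Lemma deriv_line q x y : (line q x y)^`() = line (ddir y q) x y.
Proof.
pose P r := (line r x y)^`() = line (ddir y r) x y.
have PC a : P (mpolyC d a).
  have lC b : line (mpolyC d b) x y = b%:P.
    by apply: poly_eq_fun => t; rewrite horner_line mevalC hornerC.
  by rewrite /P ddirC -(mpolyC0 d F) !lC derivC polyC0.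
have PZ a r : P r -> P (a *: r) by rewrite /P => h; rewrite lineZ derivZ h ddirZ lineZ.
have PD r1 r2 : P r1 -> P r2 -> P (r1 + r2).
  by rewrite /P => h1 h2; rewrite lineD derivD h1 h2 ddirD lineD.
have PM r1 r2 : P r1 -> P r2 -> P (r1 * r2).
  by rewrite /P => h1 h2; rewrite lineM derivM h1 h2 ddirM lineD !lineM.
have PX j : P (mpolyX F (mnm1 j)).
  rewrite /P.
  have -> : line (mpolyX F (mnm1 j)) x y = (x 0 j)%:P + y 0 j *: 'X.
    apply: poly_eq_fun => t; rewrite horner_line mevalXU !hornerE !mxE.
    by rewrite (mulrC (y 0 j)).
  have -> : ddir y (mpolyX F (mnm1 j)) = mpolyC d (y 0 j).
    rewrite /ddir (bigD1 j) //= big1 => [|k kj]; last first.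
      by rewrite mderivX mnm1E eq_sym (negbTE kj) scale0r scaler0.
    rewrite addr0 mderivX mnm1E eqxx scale1r.
    have -> : mnm_sub (mnm1 j) (mnm1 j) = mnm0.
      by apply/mnmP => k; rewrite mnmBE subnn mnm0E.
    by rewrite mpolyX0 -mul_mpolyC mulr1.
  apply: poly_eq_fun => t; rewrite horner_line mevalC derivD derivC derivZ derivX.
  by rewrite !hornerE.
change (P q); elim/mpolyind: q => [|a m q _ _ IH].
  by rewrite -(mpolyC0 d F); exact: PC.
apply: PD => //; apply: PZ; rewrite mpolyXE_id.
apply: (big_ind P); [by rewrite -mpolyC1; exact: PC|exact: PM|].
move=> j _; elim: (m j) => [|k IHk]; first by rewrite expr0 -mpolyC1; exact: PC.
by rewrite exprS; exact: PM.
Qed.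

Lemma derivn_line k q x y :
  (line q x y)^`(k) = line (iter k (ddir y) q) x y.
Proof. by elim: k => [|k IH]; rewrite ?derivn0// derivnS IH deriv_line. Qed.

Lemma coef_line k q x y :
  (line q x y)`_k *+ k`! = meval (x 0) (iter k (ddir y) q).
Proof.
have := congr1 (fun f : {poly F} => f.[0]) (derivn_line k q x y).
rewrite /= horner_line scale0r addr0 => <-.
by rewrite horner_coef0 coef_derivn addn0 ffactnn.
Qed.

Definition homog N q := q \is ishomog1 N (@mdeg d).

Lemma meval_homog N q t x : homog N q ->
  meval ((t *: x) 0) q = t ^+ N * meval (x 0) q.
Proof.
move=> /dhomogP hq; rewrite !mevalE mulr_sumr.
rewrite big_seq [RHS]big_seq; apply: eq_bigr => m /hq /= <-.
rewrite mulrCA; congr (_ * _); rewrite mdegE.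
rewrite -prodrXr -big_split/=; apply: eq_bigr => j _.
by rewrite mxE exprMn.
Qed.

Lemma size_line N q x y : homog N q -> (size (line q x y) <= N.+1)%N.
Proof.
move=> /dhomogP hq; rewrite /line /mmap big_seq.
apply: (big_ind (fun f : {poly F} => (size f <= N.+1)%N)).
- by rewrite size_poly0.
- by move=> f g hf hg; apply: leq_trans (size_polyD _ _) _; rewrite geq_max hf.
move=> m /hq /= <-; rewrite mul_polyC; apply: leq_trans (size_scale_leq _ _) _.
rewrite /mmap1 mdegE.
apply: (big_ind2 (fun (f : {poly F}) k => (size f <= k.+1)%N)).
- by rewrite size_poly1.
- move=> f k g l hf hg; apply: leq_trans (size_polyMleq _ _) _.
  by move: hf hg; lia.
move=> j _; apply: leq_trans (size_poly_exp_leq _ _) _; rewrite ltnS.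
rewrite -[leqRHS]mul1n leq_mul2r; apply/orP; right.
rewrite -subn1 leq_subLR; apply: leq_trans (size_polyD _ _) _.
rewrite geq_max (leq_trans (size_polyC_leq1 _))//.
by apply: leq_trans (size_scale_leq _ _) _; rewrite size_polyX.
Qed.

(** By homogeneity q(x + t y) = t^N q(y + t^-1 x), which reverses the coefficients. This exchanges
    derivatives along y at x with derivatives along x at y. *)
Lemma line_rev N q x y k : homog N q -> (k <= N)%N ->
  (line q x y)`_k = (line q y x)`_(N - k).
Proof.
move=> hq kN.
suff -> : line q x y = \poly_(j < N.+1) (line q y x)`_(N - j).
  by rewrite coef_poly ltnS kN.
apply: poly_eq_nonzero => t t0; rewrite horner_line horner_poly.
have -> : x + t *: y = t *: (y + t^-1 *: x).
  by rewrite scalerDr scalerA mulfV// scale1r addrC.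
rewrite (meval_homog _ _ hq) -horner_line (horner_coef_wide _ (size_line _ _ hq)).
rewrite mulr_sumr (reindex_inj rev_ord_inj) /=.
apply: eq_bigr => j _; rewrite subSS mulrCA; congr (_ * _).
have jN : (j <= N)%N by rewrite -ltnS ltn_ord.
by rewrite exprVn -{1}(subnKC jN) exprD mulfK// expf_neq0.
Qed.

Lemma coef_line_top N q x y : homog N q -> (line q x y)`_N = meval (y 0) q.
Proof.
move=> hq; rewrite (line_rev _ _ hq)// subnn -horner_coef0 horner_line.
by rewrite scale0r addr0.
Qed.

Lemma homog_ddir N y q : homog N q -> homog N.-1 (ddir y q).
Proof.
move=> /dhomogP hq; rewrite /homog /ddir.
apply: rpred_sum => j _; apply: dhomogZ; apply/dhomogP => m /=.
rewrite mcoeff_msupp mcoeff_deriv => mq.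
have : mnm_add m (mnm1 j) \in msupp q.
  by rewrite mcoeff_msupp; apply: contraNneq mq => ->; rewrite mul0rn.
by move=> /hq /=; rewrite mdegD mdeg1 addn1 => <-.
Qed.

Lemma ddir_homog0 y q : homog 0 q -> ddir y q = 0.
Proof.
move=> /dhomogP hq; rewrite /ddir big1// => j _; apply/eqP; rewrite scaler_eq0.
apply/orP; right; apply/eqP/mpolyP => m; rewrite mcoeff0 mcoeff_deriv.
rewrite memN_msupp_eq0 ?mul0rn//; apply/negP => /hq /=.
by rewrite mdegD mdeg1 addn1.
Qed.

End Lines.

(** * Roots and the upper half-plane *)

Section ComplexPolynomials.
Context {R : realType}.
Local Notation C := (complex R).
Local Notation toC := (real_complex R).
Implicit Types (f g : {poly C}) (t z : C).
Local Notation Im := (@complex.Im R).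
Local Notation Re := (@complex.Re R).
Local Notation nc := (@Normc.normc R).

Lemma toC_Re z : Im z = 0 -> toC (Re z) = z.
Proof. by case: z => a b /= ->. Qed.

Lemma ImD z1 z2 : Im (z1 + z2) = Im z1 + Im z2.
Proof. by case: z1 z2 => [a b] [a' b']. Qed.

Lemma ImN z : Im (- z) = - Im z.
Proof. by case: z. Qed.

Lemma ImB z1 z2 : Im (z1 - z2) = Im z1 - Im z2.
Proof. by rewrite ImD ImN. Qed.

Lemma ImZ (a : R) z : Im (toC a * z) = a * Im z.
Proof. by case: z => x y /=; rewrite mul0r addr0. Qed.

Lemma ImV z : Im z^-1 = - Im z / (Re z ^+ 2 + Im z ^+ 2).
Proof. by case: z => a b; rewrite /= mulNr. Qed.

Lemma nc_ge0 z : 0 <= nc z.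
Proof. by case: z => a b /=; rewrite sqrtr_ge0. Qed.

Lemma ncE z : nc z ^+ 2 = Re z ^+ 2 + Im z ^+ 2.
Proof. by case: z => a b /=; rewrite sqr_sqrtr// addr_ge0// sqr_ge0. Qed.

Lemma nc_ge_Im z : `|Im z| <= nc z.
Proof.
rewrite -(@ler_pXn2r _ 2)// ?nnegrE ?nc_ge0// ncE real_normK ?num_real//.
by rewrite lerDr sqr_ge0.
Qed.

Lemma ncD z1 z2 : nc (z1 + z2) <= nc z1 + nc z2.
Proof. exact: le_normcD. Qed.

Lemma ncM z1 z2 : nc (z1 * z2) = nc z1 * nc z2.
Proof. exact: Normc.normcM. Qed.

Lemma ncR (a : R) : nc (toC a) = `|a|.
Proof. by rewrite /= expr0n /= addr0 sqrtr_sqr. Qed.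

Lemma ncN z : nc (- z) = nc z.
Proof. by case: z => x y /=; rewrite !sqrrN. Qed.

Lemma nc_eq0 z : (nc z == 0) = (z == 0).
Proof.
apply/eqP/eqP => [/Normc.eq0_normc//|->]; exact: Normc.normc0.
Qed.

Lemma ncX z n : nc (z ^+ n) = nc z ^+ n.
Proof.
by elim: n => [|n IH]; rewrite ?expr0 ?Normc.normc1// !exprS ncM IH.
Qed.

Lemma nc_sum (I : Type) (r : seq I) (G : I -> C) :
  nc (\sum_(i <- r) G i) <= \sum_(i <- r) nc (G i).
Proof.
elim: r => [|i r IH]; first by rewrite !big_nil Normc.normc0.
by rewrite !big_cons; apply: le_trans (ncD _ _) _; rewrite lerD2l.
Qed.

Lemma ncB z1 z2 : nc z1 - nc z2 <= nc (z1 - z2).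
Proof. by rewrite lerBlDr; apply: le_trans (ncD _ _); rewrite subrK. Qed.

Lemma real_rooted_split (P : {poly R}) :
  (forall t, (map_poly toC P).[t] = 0 -> Im t = 0) ->
  exists s : seq R, P = lead_coef P *: \prod_(a <- s) ('X - a%:P).
Proof.
move=> hP; have [s hs] := closed_field_poly_normal (map_poly toC P).
have [->|P0] := eqVneq P 0.
  by exists [::]; rewrite lead_coef0 scale0r.
have lP0 : lead_coef (map_poly toC P) != 0.
  by rewrite lead_coef_eq0 map_poly_eq0.
exists [seq Re z | z <- s]; apply: (map_poly_inj toC).
rewrite map_polyZ /= -lead_coef_map {1}hs; congr (_ *: _).
rewrite rmorph_prod /= big_map; apply: eq_big_seq => z zs.
rewrite map_polyXsubC /= toC_Re//; apply: hP; rewrite hs hornerZ.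
apply/eqP; rewrite mulf_eq0; apply/orP; right.
by rewrite -rootE root_prod_XsubC.
Qed.

Lemma prod_XaddC_coef_gt0 (s : seq R) : all (fun a => a < 0) s ->
  forall j, (j <= size s)%N -> 0 < (\prod_(a <- s) ('X - a%:P))`_j.
Proof.
elim: s => [_ [|//] _|a s IH /= /andP[a0 /IH {}IH] j js].
  by rewrite big_nil coef1.
rewrite big_cons mulrBl coefB coefXM coefCM.
have sz : size (\prod_(a <- s) ('X - a%:P)) = (size s).+1.
  by rewrite size_prod_XsubC.
have Na : 0 < - a by rewrite oppr_gt0.
case: j js => [|j] js /=; first by rewrite sub0r -mulNr mulr_gt0// IH.
rewrite ltnS in js; apply: ltr_wpDr; last exact: IH.
rewrite -mulNr mulr_ge0 ?(ltW Na)//.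
have [jl|] := ltnP j (size s); first exact/ltW/IH.
by move=> sj; rewrite nth_default// sz ltnS.
Qed.

(* If a real-rooted polynomial is positive on [0, +oo[, all its roots are
   negative. *)
Lemma real_rooted_coef_gt0 (P : {poly R}) :
  (forall t, (map_poly toC P).[t] = 0 -> Im t = 0) ->
  0 < lead_coef P -> (forall a, 0 <= a -> P.[a] != 0) ->
  forall j, (j < size P)%N -> 0 < P`_j.
Proof.
move=> rP lP P0 j jP; have [s hs] := real_rooted_split rP.
rewrite hs coefZ mulr_gt0//; apply: prod_XaddC_coef_gt0; last first.
  by move: jP; rewrite {1}hs size_scale ?gt_eqF// size_prod_XsubC ltnS.
apply/allP => a sa; rewrite ltNge; apply/negP => /P0.
rewrite hs hornerZ mulf_eq0 gt_eqF//=.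
by rewrite -rootE root_prod_XsubC sa.
Qed.

(** The logarithmic derivative at 0 is the sum of - 1 / z over the roots z. All roots lie strictly
    below the real axis, so each term has negative imaginary part, and the sum is strictly negative
    once there is a root. *)
Lemma Im_logder f : (forall t, 0 <= Im t -> f.[t] != 0) ->
  Im (f^`().[0] / f.[0]) <= 0 /\
  ((1 < size f)%N -> Im (f^`().[0] / f.[0]) < 0).
Proof.
move=> hf; have [s hs] := closed_field_poly_normal f.
have f0 : lead_coef f != 0.
  by apply: contraNneq (hf 0 (lexx 0)) => l0; rewrite hs l0 scale0r horner0.
have sneg : all (fun z => Im z < 0) s.
  apply/allP => z zs; rewrite ltNge; apply/negP => /hf; rewrite hs hornerZ.
  by rewrite mulf_eq0 (negbTE f0)/= -rootE root_prod_XsubC zs.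
have -> : (1 < size f)%N = (0 < size s)%N.
  by rewrite hs size_scale// size_prod_XsubC ltnS.
rewrite hs derivZ !hornerZ -mulf_div divff// mul1r.
elim: s sneg {hs} => [_|z s IH /= /andP[z0 sneg]].
  by rewrite big_nil derivC horner0 mul0r.
rewrite big_cons derivM derivXsubC mul1r hornerD !hornerM hornerXsubC sub0r.
set G := (\prod_(a <- s) _) in IH *.
have z1 : z != 0 by apply: contraTneq z0 => ->; rewrite ltxx.
have G0 : G.[0] != 0.
  rewrite -rootE root_prod_XsubC; apply/negP => s0.
  by move/allP: sneg => /(_ _ s0) /=; rewrite ltxx.
have -> : (G.[0] + - z * G^`().[0]) / (- z * G.[0]) = G^`().[0] / G.[0] - z^-1.
  by field; rewrite z1 G0.
rewrite ImB ImV mulNr opprK.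
have h : Im z / (Re z ^+ 2 + Im z ^+ 2) < 0.
  rewrite nmulr_rlt0// invr_gt0 ltr_wpDl ?sqr_ge0//.
  by rewrite exprn_even_gt0//= lt_eqF.
by have [IH' _] := IH sneg; split=> [|_]; lra.
Qed.

Lemma nc_prod_ge (s : seq C) t (eta : R) : 0 <= eta ->
  (forall z, z \in s -> eta <= nc (t - z)) ->
  eta ^+ size s <= nc (\prod_(z <- s) ('X - z%:P)).[t].
Proof.
move=> e0; elim: s => [_|z s IH hs].
  by rewrite big_nil hornerC Normc.normc1.
rewrite big_cons hornerM ncM hornerXsubC exprS ler_pM ?exprn_ge0//.
  by apply: hs; rewrite mem_head.
by apply: IH => w ws; apply: hs; rewrite in_cons ws orbT.
Qed.

(** The upper half-plane is not compact; the factor 1 + |t| per root makes the bound uniform up to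
    infinity, as [no_upper_root_persist] requires. *)
Lemma nc_prod_lower (s : seq C) : all (fun z => Im z < 0) s ->
  exists2 k : R, 0 < k & forall t, 0 <= Im t ->
    k * (1 + nc t) ^+ size s <= nc (\prod_(z <- s) ('X - z%:P)).[t].
Proof.
elim: s => [_|z s IH /= /andP[z0 /IH [k k0 hk]]].
  by exists 1 => // t _; rewrite big_nil hornerC Normc.normc1 mulr1.
pose e := - Im z; pose B := nc z.
have e0 : 0 < e by rewrite oppr_gt0.
have B0 : 0 <= B := nc_ge0 z.
(* The distance from t to z is at least e and at least |t| - B. The two bounds agree at |t| = B + e,
   where their ratio to 1 + |t| is c. *)
pose c := e / (1 + B + e).
have D0 : 0 < 1 + B + e by lra.
have c0 : 0 < c by rewrite divr_gt0.
have cD : c * (1 + B + e) = e by rewrite mulfVK// gt_eqF.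
exists (c * k) => [|t t0]; first by rewrite mulr_gt0.
rewrite big_cons hornerM ncM hornerXsubC exprS mulrACA.
have nt := nc_ge0 t.
rewrite ler_pM ?hk//; try by rewrite mulr_ge0 ?exprn_ge0// ?ltW//; lra.
have h1 : e <= nc (t - z).
  by apply: le_trans (nc_ge_Im _); rewrite ImB; apply: le_trans (ler_norm _); rewrite /e; lra.
have h2 := ncB t z; rewrite -/B in h2.
have c1 : c <= 1 by rewrite ler_pdivrMr//; lra.
have [|] := leP (nc t) (B + e) => hB.
  by apply: le_trans h1; rewrite -cD ler_pM2l//; lra.
apply: le_trans h2.
have : c * (nc t - (B + e)) <= 1 * (nc t - (B + e)) by rewrite ler_wpM2r//; lra.
by move: cD; nra.
Qed.

Lemma poly_small f (eps : R) : f.[0] = 0 -> 0 < eps ->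
  exists2 delta : R, 0 < delta & forall a : R, `|a| < delta ->
    nc f.[toC a] < eps.
Proof.
move=> f0 e0; have /factor_theorem[g hg] : root f 0 by rewrite rootE f0.
rewrite subr0 in hg.
pose M := \sum_(j <- iota 0 (size g)) nc g`_j.
have M0 : 0 <= M by rewrite sumr_ge0// => j _; exact: nc_ge0.
exists (Num.min 1 (eps / (1 + M))) => [|a].
  by rewrite lt_min ltr01 divr_gt0//; lra.
rewrite lt_min => /andP[a1 a2].
rewrite hg hornerM hornerX ncM ncR.
have : nc g.[toC a] <= M.
  rewrite horner_coef; apply: le_trans (nc_sum _ _) _.
  rewrite /M -[X in _ <= \sum_(j <- iota 0 X) _]subn0 big_mkord.
  apply: ler_sum => j _; rewrite ncM -[leRHS]mulr1 ler_wpM2l ?nc_ge0//.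
  by rewrite ncX ncR exprn_ile1// ltW.
move=> h; have a0 := normr_ge0 a.
rewrite ltr_pdivlMr in a2; last by lra.
apply: le_lt_trans a2; rewrite mulrC ler_wpM2l//; lra.
Qed.

End ComplexPolynomials.

(** * Garding's theorem *)

Section RootPerturbation.
Context {R : realType} {d : nat}.
Local Notation C := (complex R).
Local Notation toC := (real_complex R).
Local Notation Im := (@complex.Im R).
Local Notation nc := (@Normc.normc R).
Implicit Types (q : mpoly d C) (X Y a : 'rV[C]_d) (t : C).

Lemma line_split q N X a : homog N q -> meval (a 0) q != 0 ->
  exists s : seq C, [/\ size s = N,
    line q X a = meval (a 0) q *: \prod_(z <- s) ('X - z%:P) &
    forall t, (t \in s) = (meval ((X + t *: a) 0) q == 0)].
Proof.
move=> hq qa; have [s hs] := closed_field_poly_normal (line q X a).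
have sz : size (line q X a) = N.+1.
  apply/eqP; rewrite eqn_leq size_line//= ltnNge; apply/negP => h.
  by move: qa; rewrite -(coef_line_top X a hq) nth_default ?eqxx.
have lc : lead_coef (line q X a) = meval (a 0) q.
  by rewrite lead_coefE sz /= (coef_line_top X a hq).
rewrite lc in hs; exists s; split => // [|t].
  by move: sz; rewrite hs size_scale// size_prod_XsubC => -[].
rewrite -horner_line hs hornerZ mulf_eq0 (negbTE qa)/=.
by rewrite -rootE root_prod_XsubC.
Qed.

(** If the perturbed polynomial had no root in the open upper half-plane, all its roots would be at
    distance at least Im t0 from t0, so its value at t0 would have modulus at least |q(a)| (Im
    t0)^N. That value tends to 0 with r. *)
Lemma upper_root_persist q N X Y a t0 : homog N q -> meval (a 0) q != 0 ->
  meval ((X + t0 *: a) 0) q = 0 -> 0 < Im t0 ->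
  exists2 delta : R, 0 < delta & forall r : R, `|r| < delta ->
    exists2 t, 0 < Im t & meval ((X + toC r *: Y + t *: a) 0) q = 0.
Proof.
move=> hq qa q0 t00; pose g := line q (X + t0 *: a) Y.
have g0 : g.[0] = 0 by rewrite horner_line scale0r addr0.
have e0 : 0 < nc (meval (a 0) q) * Im t0 ^+ N.
  by rewrite mulr_gt0 ?exprn_gt0// lt_def nc_ge0 nc_eq0 qa.
have [delta d0 hd] := poly_small g0 e0; exists delta => // r /hd.
rewrite horner_line => small.
have [s [sN hs rs]] := line_split (X + toC r *: Y) hq qa.
have [/hasP[t ts t_gt0]|/hasPn/= hs0] := boolP (has (fun z => 0 < Im z) s).
  by exists t => //; apply/eqP; rewrite -rs.
exfalso; move: small; rewrite addrAC -horner_line hs hornerZ ncM.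
rewrite ltr_pM2l; last by rewrite lt_def nc_ge0 nc_eq0 qa.
rewrite ltNge -sN nc_prod_ge//; first exact: ltW.
move=> z /hs0; rewrite -leNgt => z0; apply: le_trans (nc_ge_Im _).
by apply: le_trans (ler_norm _); rewrite ImB lerBrDr gerDl.
Qed.

Lemma common_delta (n : nat) (Q : nat -> R -> Prop) :
  (forall j, (j < n)%N -> exists2 delta : R, 0 < delta &
    forall r : R, `|r| < delta -> Q j r) ->
  exists2 delta : R, 0 < delta &
    forall j r, (j < n)%N -> `|r| < delta -> Q j r.
Proof.
elim: n => [_|n IH hQ]; first by exists 1.
have [j jn|d1 d10 h1] := IH; first by apply: hQ; rewrite ltnS ltnW.
have [d2 d20 h2] := hQ n (leqnn _).
exists (Num.min d1 d2) => [|j r]; first by rewrite lt_min d10.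
rewrite ltnS leq_eqVlt lt_min => /orP[/eqP-> /andP[_]|jn /andP[r1 _]].
  exact: h2.
exact: h1.
Qed.

Lemma no_upper_root_persist q N X Y a : homog N q -> meval (a 0) q != 0 ->
  (forall t, 0 <= Im t -> meval ((X + t *: a) 0) q != 0) ->
  exists2 delta : R, 0 < delta & forall r : R, `|r| < delta ->
    forall t, 0 <= Im t -> meval ((X + toC r *: Y + t *: a) 0) q != 0.
Proof.
move=> hq qa q0; have [s [sN hs rs]] := line_split X hq qa.
have sneg : all (fun z => Im z < 0) s.
  apply/allP => z; rewrite rs ltNge => qz; apply/negP => /q0.
  by rewrite qz.
have [k k0 hk] := nc_prod_lower sneg.
have c0 : 0 < nc (meval (a 0) q) by rewrite lt_def nc_ge0 nc_eq0 qa.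
(* A line of degree N has N + 1 coefficients; dividing by N + 2 keeps the total error strictly below
   the lower bound from [nc_prod_lower]. *)
pose eps := nc (meval (a 0) q) * k / (N.+2)%:R.
have eps0 : 0 < eps by rewrite divr_gt0// mulr_gt0.
have [j _|delta d0 hd] := @common_delta N.+1
  (fun j r => nc ((line q (X + toC r *: Y) a)`_j - (line q X a)`_j) < eps).
  pose h := line (iter j (ddir a) q) X Y.
  have h0 : (h - (h.[0])%:P).[0] = 0 by rewrite !hornerE subrr.
  have [delta d0 hd] := poly_small h0 eps0; exists delta => // r /hd.
  rewrite hornerD hornerN hornerC !horner_line scale0r addr0 -!coef_line.
  rewrite -mulrnBl; apply: le_lt_trans; rewrite -mulr_natr ncM.
  rewrite ler_peMr ?nc_ge0//.
  have -> : (j`!%:R : C) = toC j`!%:R by rewrite rmorph_nat.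
  by rewrite ncR ger0_norm// ler1n fact_gt0.
exists delta => // r rd t t0; apply/negP => /eqP hr.
have := hk _ t0; rewrite sN => hk'.
pose f0 := line q X a; pose f := line q (X + toC r *: Y) a.
have h1 : nc (meval (a 0) q) * k * (1 + nc t) ^+ N <= nc f0.[t].
  by rewrite /f0 hs hornerZ ncM -mulrA ler_pM2l.
have fr : f.[t] = 0 by rewrite horner_line.
have h2 : nc f0.[t] <= N.+1%:R * eps * (1 + nc t) ^+ N.
  have -> : f0.[t] = - (f.[t] - f0.[t]) by rewrite fr sub0r opprK.
  rewrite ncN (horner_coef_wide _ (size_line X a hq)).
  rewrite (horner_coef_wide _ (size_line (X + toC r *: Y) a hq)) -sumrB.
  apply: le_trans (nc_sum _ _) _.
  rewrite -mulrA mulr_natl -[in leRHS](card_ord N.+1) -sumr_const.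
  apply: ler_sum => j _; rewrite -mulrBl ncM ncX ler_pM ?nc_ge0 ?exprn_ge0 ?nc_ge0//.
    by apply: ltW; apply: hd; rewrite ?ltn_ord.
  have nt := nc_ge0 t.
  apply: (@le_trans _ _ ((1 + nc t) ^+ j)).
    by rewrite lerXn2r ?nnegrE//; lra.
  by rewrite ler_weXn2l// ?lerDl// -ltnS.
have pos : 0 < (1 + nc t) ^+ N by rewrite exprn_gt0// ltr_pwDl// nc_ge0.
have : nc (meval (a 0) q) * k <= N.+1%:R * eps.
  by rewrite -(ler_pM2r pos); apply: le_trans h2.
apply/negP; rewrite -ltNge /eps mulrCA gtr_pMr ?mulr_gt0//.
by rewrite ltr_pdivrMr// mul1r ltr_nat.
Qed.

End RootPerturbation.

Lemma scale_comb (F : fieldType) (V : lmodType F) (a s t : F) (u v w : V) :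
  a * s = 1 -> a *: (u + s *: v + t *: w) = a *: u + v + (a * t) *: w.
Proof. by move=> as1; rewrite !scalerDr !scalerA as1 scale1r. Qed.

(** * Hyperbolicity as absence of zeros with a given imaginary part *)

Section Garding.
Context {R : realType} {d : nat}.
Local Notation C := (complex R).
Local Notation toC := (real_complex R).
Local Notation Im := (@complex.Im R).
Local Notation Re := (@complex.Re R).
Local Notation vC := (map_mx toC).
Local Notation ii := (Complex 0 1 : C).
Implicit Types (P : mpoly d R) (x y e a : 'rV[R]_d) (t : C).

Lemma map_mpoly_ddir y P :
  map_mpoly toC (dirderiv y P) = ddir (vC y) (map_mpoly toC P).
Proof.
rewrite /dirderiv /ddir rmorph_sum; apply: eq_bigr => j _ /=.
rewrite map_mpolyZ mxE; congr (_ *: _); apply/mpolyP => m.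
by rewrite mcoeff_map_mpoly !mcoeff_deriv mcoeff_map_mpoly raddfMn.
Qed.

Lemma homogC N P : homog N P -> homog N (map_mpoly toC P).
Proof.
move=> /dhomogP hP; apply/dhomogP => m; rewrite mcoeff_msupp mcoeff_map_mpoly.
by rewrite fmorph_eq0 => mP; apply: hP; rewrite mcoeff_msupp.
Qed.

Lemma meval_real P x : meval ((vC x) 0) (map_mpoly toC P) = toC (evalp P x).
Proof.
rewrite /evalp mevalE [in RHS]mevalE.
rewrite (perm_big _ (msupp_map_mpoly _ (@complexI R))) /=.
rewrite raddf_sum /=; apply: eq_bigr => m _.
rewrite mcoeff_map_mpoly rmorphM rmorph_prod; congr (_ * _).
by apply: eq_bigr => j _; rewrite mxE rmorphXn.
Qed.

Lemma iter_map_ddir k y P :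
  map_mpoly toC (dirderivn k y P) = iter k (ddir (vC y)) (map_mpoly toC P).
Proof. by elim: k => //= k IH; rewrite map_mpoly_ddir IH. Qed.

Lemma map_line P x y :
  map_poly toC (line P x y) = line (map_mpoly toC P) (vC x) (vC y).
Proof.
apply/polyP => k; rewrite coef_map /=.
have kf : (k`!%:R : C) != 0 by rewrite pnatr_eq0 -lt0n fact_gt0.
apply: (mulIf kf); rewrite !mulr_natr coef_line -iter_map_ddir meval_real.
by rewrite -rmorphMn /= coef_line.
Qed.

Lemma evalp_lineE P x e t :
  evalp_line P x e t = (line (map_mpoly toC P) (vC x) (vC e)).[t].
Proof.
by rewrite horner_line; apply: meval_eq => j; rewrite !mxE.
Qed.

Lemma evalp_line_real P x e t : evalp_line P x e t =
  meval ((vC (x + Re t *: e) + toC (Im t) *: (ii *: vC e)) 0) (map_mpoly toC P).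
Proof.
apply: meval_eq => j; rewrite !mxE [t in LHS]complexE !(rmorphD toC) !(rmorphM toC)/=.
by rewrite complexiE mulrDl addrA; congr (_ + _); rewrite mulrCA mulrA.
Qed.

Lemma vCD x y : vC (x + y) = vC x + vC y.
Proof. exact: map_mxD. Qed.

Lemma vCZ (c : R) x : vC (c *: x) = toC c *: vC x.
Proof. exact: map_mxZ. Qed.

Lemma vC0 : vC 0 = 0 :> 'rV[C]_d.
Proof. exact: map_mx0. Qed.

(** This is hyperbolicity in direction a rephrased without roots: for homogeneous P, dividing by Im
    t moves a nonreal root t to a zero with imaginary part a. *)
Definition stable_at P a :=
  forall x, meval ((vC x + ii *: vC a) 0) (map_mpoly toC P) != 0.

Lemma stable_hyperbolic N P a : homog N P -> 0 < evalp P a ->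
  stable_at P a -> hyperbolic P a.
Proof.
move=> hP Pa sP; split=> // x t; rewrite evalp_line_real => h.
have [//|t0] := eqVneq (Im t) 0.
have /negP[] := sP ((Im t)^-1 *: (x + Re t *: a)).
have T0 : toC (Im t) != 0 by rewrite fmorph_eq0.
have E : vC (x + Re t *: a) + toC (Im t) *: (ii *: vC a) =
    toC (Im t) *: (vC ((Im t)^-1 *: (x + Re t *: a)) + ii *: vC a).
  rewrite [RHS]scalerDr; congr (_ + _).
  by rewrite vCZ scalerA -(rmorphM toC) mulfV// (rmorph1 toC) scale1r.
move: h; rewrite {}E (meval_homog _ _ (homogC hP)) => /eqP.
by rewrite mulf_eq0 expf_eq0 (negbTE T0) andbF.
Qed.

(* Garding's theorem, by continuity of the roots of t |-> P(r x + t a + i e)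
   as r grows from 0: they start in the lower half-plane and cannot cross the
   real axis. *)
Lemma hyperbolic_stable N P e a : homog N P -> hyperbolic P e ->
  (forall r : R, 0 <= r -> evalp P (a + r *: e) != 0) -> stable_at P a.
Proof.
move=> hP [Pe rP] Pae x; apply/negP => /eqP Pxa.
set q := map_mpoly toC P in Pxa *.
have hq : homog N q := homogC hP.
have qa : meval ((vC a) 0) q != 0.
  by rewrite meval_real fmorph_eq0; have := Pae 0 (lexx _); rewrite scale0r addr0.
pose V r := exists2 t, 0 < Im t &
  meval ((vC (r *: x) + ii *: vC e + t *: vC a) 0) q = 0.
(* A real root b would make i a root of s |-> P(r x + b a + s e), against hyperbolicity along e. *)
have real_ne r (b : R) :
    meval ((vC (r *: x) + ii *: vC e + toC b *: vC a) 0) q != 0.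
  apply/negP => /eqP h.
  suff /rP /eqP : evalp_line P (r *: x + b *: a) e ii = 0.
    by rewrite oner_eq0.
  have E : vC (r *: x + b *: a) + ii *: vC e =
      vC (r *: x) + ii *: vC e + toC b *: vC a.
    by rewrite vCD (vCZ b) [LHS]addrAC.
  by rewrite evalp_lineE horner_line E.
(* At r = 0, homogeneity turns a root t into the root i / t of s |-> P(a + s e). It is real by
   hyperbolicity, and nonnegative since t lies in the upper half-plane, which the hypothesis on a
   excludes. *)
have V0 : ~ V 0.
  move=> [t t0]; rewrite scale0r vC0 add0r => h.
  have tn0 : t != 0 by apply: contraTneq t0 => ->; rewrite ltxx.
  have h1 : evalp_line P a e (ii / t) = 0.
    have E : ii *: vC e + t *: vC a = t *: (vC a + (ii / t) *: vC e).
      have tii : t * (ii / t) = ii by rewrite mulrCA mulfV// mulr1.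
      by rewrite [RHS]scalerDr [t *: (_ *: _)]scalerA tii [LHS]addrC.
    move/eqP: h; rewrite {}E (meval_homog _ _ hq) evalp_lineE horner_line.
    by rewrite mulf_eq0 expf_eq0 (negbTE tn0) andbF => /eqP.
  have rt := rP _ _ h1; pose rho := Re (ii / t).
  have hrho : toC rho = ii / t by rewrite toC_Re.
  have rn0 : rho != 0.
    apply/eqP => r0; move: hrho; rewrite r0 (rmorph0 toC) => /esym/eqP.
    by rewrite mulf_eq0 invr_eq0 (negbTE tn0) orbF => /eqP[/eqP]; rewrite oner_eq0.
  have trho : toC rho * t = ii by rewrite hrho mulfVK.
  have : 0 <= rho.
    have := congr1 Im trho; rewrite ImZ /= => rt1.
    rewrite leNgt; apply/negP => r0.
    have : rho * Im t < 0 by rewrite nmulr_rlt0.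
    by rewrite rt1 ltNge ler01.
  have : toC (evalp P (a + rho *: e)) == 0.
    by rewrite -meval_real vCD vCZ hrho -horner_line -evalp_lineE h1.
  by rewrite fmorph_eq0 => /eqP Pr /Pae; rewrite Pr eqxx.
(* The assumed zero at x + i a is the root t = i before the term i e is added. It survives a small
   multiple of i e, and rescaling that multiple to 1 gives some r0 with [V r0]. *)
have [delta d0 hd] := @upper_root_persist _ _ q N (vC x) (ii *: vC e) (vC a) ii
   hq qa Pxa ltr01.
have h2 : 0 < delta / 2 by rewrite divr_gt0.
have [|t t0 ht] := hd (delta / 2).
  by rewrite gtr0_norm// ltr_pdivrMr//; lra.
pose r0 := (delta / 2)^-1.
have r00 : 0 < r0 by rewrite invr_gt0.
have Vr0 : V r0.
  exists (toC r0 * t); first by rewrite ImZ mulr_gt0.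
  rewrite vCZ.
  have <- : toC r0 *: (vC x + toC (delta / 2) *: (ii *: vC e) + t *: vC a) =
      toC r0 *: vC x + ii *: vC e + (toC r0 * t) *: vC a.
    apply: scale_comb; rewrite -(rmorphM toC) mulVf ?(gt_eqF h2)//.
  by rewrite (meval_homog _ _ hq) ht mulr0.
pose S := [set r : R | 0 <= r /\ V r].
have S0 : has_inf S.
  split; first by exists r0; split; [exact: ltW|].
  by exists 0 => r /= [].
(* At the infimum both cases fail: if [V rs] holds, then rs > 0 and an upper root persists slightly
   below rs; otherwise there is no root in the closed upper half-plane at rs, hence none slightly
   above. *)
pose rs := inf S.
have rs0 : 0 <= rs by apply: lb_le_inf; [by case: S0|by move=> r /= []].
have shift r s : vC (rs *: x) + ii *: vC e + toC s *: vC x + r =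
    vC ((rs + s) *: x) + ii *: vC e + r.
  by rewrite scalerDl vCD (vCZ s); congr (_ + r); rewrite [LHS]addrAC.
have [[t1 t10 ht1]|nV] := pselect (V rs).
  have rsgt : 0 < rs.
    rewrite lt_def rs0 andbT; apply/negP => /eqP r0E.
    by apply: V0; rewrite -r0E; exists t1.
  have [dl dl0 hdl] := upper_root_persist (vC x) hq qa ht1 t10.
  pose s := Num.min (dl / 2) rs.
  have s0 : 0 < s by rewrite lt_min rsgt divr_gt0.
  have sdl : s < dl by rewrite gt_min ltr_pdivrMr//; apply/orP; left; lra.
  have srs : s <= rs by rewrite ge_min lexx orbT.
  have [|t2 t20] := hdl (- s); first by rewrite normrN gtr0_norm.
  rewrite shift => ht2.
  have : rs <= rs - s.
    apply: ge_inf; first by case: S0.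
    by split; [lra|exists t2].
  by lra.
have [|dl dl0 hdl] := @no_upper_root_persist _ _ q N
    (vC (rs *: x) + ii *: vC e) (vC x) (vC a) hq qa.
  move=> t1; rewrite le_eqVlt => /orP[/eqP t10|t10].
    by rewrite -(toC_Re (esym t10)).
  by apply/negP => /eqP h; apply: nV; exists t1.
have [r [r_ge0 [t1 t10 ht1]] rlt] := inf_adherent dl0 S0.
have rle : rs <= r by apply: ge_inf; [case: S0|split=> //; exists t1].
have rr : `|r - rs| < dl.
  by rewrite ger0_norm ?subr_ge0//; rewrite -/rs in rlt; lra.
have := hdl _ rr _ (ltW t10).
by rewrite shift subrKC ht1 eqxx.
Qed.

End Garding.

(** * Hyperbolicity cones *)

Section RealLines.
Context {R : realType} {d : nat}.
Implicit Types (P : mpoly d R) (x y e a : 'rV[R]_d).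

Lemma horner_lineR P x y (r : R) : (line P x y).[r] = evalp P (x + r *: y).
Proof. exact: horner_line. Qed.

Lemma coef_lineR k P x y :
  (line P x y)`_k *+ k`! = evalp (dirderivn k y P) x.
Proof. exact: coef_line. Qed.

Lemma dirderivnD j k e P : dirderivn j e (dirderivn k e P) = dirderivn (j + k) e P.
Proof. by rewrite /dirderivn iterD. Qed.

Lemma homog_dirderiv N y P : homog N P -> homog N.-1 (dirderiv y P).
Proof. exact: homog_ddir. Qed.

Lemma homog_dirderivn N k e P : homog N P -> homog (N - k) (dirderivn k e P).
Proof.
move=> hP; elim: k => [|k IH]; first by rewrite subn0.
by rewrite subnS; exact: homog_ddir.
Qed.

Lemma dirderivn_gt0E j e P x :
  (0 < evalp (dirderivn j e P) x) = (0 < (line P x e)`_j).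
Proof. by rewrite -coef_lineR pmulrn_lgt0 ?fact_gt0. Qed.

Lemma dirderivn_ge0E j e P x :
  (0 <= evalp (dirderivn j e P) x) = (0 <= (line P x e)`_j).
Proof. by rewrite -coef_lineR pmulrn_lge0 ?fact_gt0. Qed.

Lemma dirderivn_eq0E j e P x :
  (evalp (dirderivn j e P) x == 0) = ((line P x e)`_j == 0).
Proof. by rewrite -coef_lineR mulrn_eq0 eqn0Ngt fact_gt0. Qed.

Lemma dirderivn_over N j e P x : homog N P -> (N < j)%N ->
  evalp (dirderivn j e P) x = 0.
Proof.
move=> hP Nj; apply/eqP; rewrite dirderivn_eq0E nth_default//.
exact: leq_trans (size_line _ _ hP) _.
Qed.

Lemma evalp_homog N P (r : R) x : homog N P ->
  evalp P (r *: x) = r ^+ N * evalp P x.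
Proof. exact: meval_homog. Qed.

Lemma taylor_le P x y (r : R) : 0 <= r ->
  (forall k, 0 <= evalp (dirderivn k y P) x) -> evalp P x <= evalp P (x + r *: y).
Proof.
move=> r0 h; rewrite -horner_lineR horner_coef.
have c0 : evalp P x = (line P x y)`_0.
  by rewrite -horner_coef0 horner_lineR scale0r addr0.
case E : (size (line P x y)) => [|n].
  by rewrite big_ord0 c0 nth_default ?E.
rewrite big_ord_recl expr0 mulr1 c0 lerDl sumr_ge0// => k _.
by rewrite mulr_ge0 ?exprn_ge0// -dirderivn_ge0E.
Qed.

Lemma taylor_gt0 j P x y (r : R) : 0 < r ->
  (forall k, 0 <= evalp (dirderivn k y P) x) ->
  0 < evalp (dirderivn j y P) x -> 0 < evalp P (x + r *: y).
Proof.
move=> r0 h; rewrite dirderivn_gt0E => hj; rewrite -horner_lineR horner_coef.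
have js : (j < size (line P x y))%N.
  by rewrite ltnNge; apply/negP => /(nth_default 0) E; rewrite E ltxx in hj.
rewrite (bigD1 (Ordinal js))//= ltr_pwDl ?mulr_gt0 ?exprn_gt0// sumr_ge0// => k _.
by rewrite mulr_ge0 ?exprn_ge0 ?(ltW r0)// -dirderivn_ge0E.
Qed.

Lemma poly_gt0_near (f : {poly R}) : 0 < f.[0] ->
  exists2 delta : R, 0 < delta & forall r : R, `|r| < delta -> 0 < f.[r].
Proof.
move=> f0; pose g := map_poly (real_complex R) (f - (f.[0])%:P).
have gE (r : R) : g.[real_complex R r] = real_complex R (f.[r] - f.[0]).
  by rewrite /g horner_map !hornerE.
have g0 : g.[0] = 0.
  by have := gE 0; rewrite (rmorph0 (real_complex R)) subrr => ->.
have [delta d0 hd] := poly_small g0 f0; exists delta => // r /hd.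
by rewrite gE ncR ltr_norml => /andP[]; lra.
Qed.

Lemma poly_ge0_limit (f : {poly R}) : (forall r, 0 < r -> 0 <= f.[r]) -> 0 <= f.[0].
Proof.
move=> hf; rewrite leNgt; apply/negP => f0.
have [|delta d0 hd] := @poly_gt0_near (- f); first by rewrite hornerN oppr_gt0.
have d2 : 0 < delta / 2 by rewrite divr_gt0.
have dd : `|delta / 2| < delta by rewrite gtr0_norm// ltr_pdivrMr//; lra.
by have := hd _ dd; rewrite hornerN oppr_gt0 ltNge hf.
Qed.

Lemma poly_eq0_near (f : {poly R}) (delta : R) : 0 < delta ->
  (forall r, 0 < r -> r < delta -> f.[r] = 0) -> f = 0.
Proof.
move=> d0 hf; pose s := [seq delta / (k.+2)%:R | k <- iota 0 (size f)].
apply: (@roots_geq_poly_eq0 _ _ s); last by rewrite size_map size_iota.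
  apply/allP => _ /mapP[k _ ->]; rewrite rootE hf ?divr_gt0//.
  by rewrite ltr_pdivrMr// ltr_pMr// ltr1n.
rewrite map_inj_uniq ?iota_uniq// => i j /(mulfI (lt0r_neq0 d0)) /invr_inj /eqP.
by rewrite eqr_nat => /eqP[].
Qed.

Lemma poly_gt0_right (f : {poly R}) m : (forall k, (k < m)%N -> f`_k = 0) ->
  0 < f`_m ->
  exists2 delta : R, 0 < delta & forall r, 0 < r -> r < delta -> 0 < f.[r].
Proof.
move=> f0 fm.
have -> : f = drop_poly m f * 'X^m.
  rewrite -[LHS](poly_take_drop m); suff -> : take_poly m f = 0 by rewrite add0r.
  by apply/polyP => k; rewrite coef_take_poly coef0; case: ltnP => // /f0.
have [|delta d0 hd] := @poly_gt0_near (drop_poly m f).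
  by rewrite horner_coef0 coef_drop_poly.
exists delta => // r r0 rd; rewrite hornerM hornerXn mulr_gt0 ?exprn_gt0//.
by apply: hd; rewrite gtr0_norm.
Qed.

Lemma evalp_continuous P : continuous (evalp P).
Proof.
have CC c : continuous (evalp (mpolyC d c) : 'rV[R]_d -> R).
  have -> : evalp (mpolyC d c) = cst c by apply/funext => y; rewrite /evalp mevalC.
  exact: cst_continuous.
have CM (q1 q2 : mpoly d R) : continuous (evalp q1) -> continuous (evalp q2) ->
    continuous (evalp (q1 * q2)).
  move=> h1 h2 x; have -> : evalp (q1 * q2) = evalp q1 * evalp q2.
    by apply/funext => y; rewrite /evalp mevalM.
  by apply: continuousM; [exact: h1|exact: h2].
elim/mpolyind: P => [|c m P _ _ IH]; first by rewrite -(mpolyC0 d R).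
suff h : continuous (evalp (mpolyX R m)).
  move=> x; have -> : evalp (c *: mpolyX R m + P) =
      (evalp (mpolyC d c * mpolyX R m) + evalp P).
    by apply/funext => y; rewrite /evalp mevalD mul_mpolyC.
  by apply: continuousD; [exact: (CM _ _ (CC c) h x)|exact: IH].
rewrite mpolyXE_id; have C1 : continuous (evalp (1 : mpoly d R)) by rewrite -mpolyC1; exact: CC.
apply: (big_ind (fun q : mpoly d R => continuous (evalp q))) => // j _.
elim: (m j) => [|k IHk]; first by rewrite expr0.
rewrite exprS; apply: CM => //.
have -> : evalp (mpolyX R (mnm1 j)) = (fun y : 'rV[R]_d => y 0 j).
  by apply/funext => y; rewrite /evalp mevalXU.
exact: coord_continuous.
Qed.

End RealLines.

(** * Hyperbolicity cones as solution sets of polynomial inequalities *)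

Section Cones.
Context {R : realType} {d : nat}.
Implicit Types (P : mpoly d R) (x y e a : 'rV[R]_d).

Definition pcone P e N : set 'rV[R]_d :=
  [set x | forall j, (j <= N)%N -> 0 < evalp (dirderivn j e P) x].

Definition pcone_closed P e N : set 'rV[R]_d :=
  [set x | forall j, (j <= N)%N -> 0 <= evalp (dirderivn j e P) x].

Lemma hyperbolic_line P e x (t : complex R) : hyperbolic P e ->
  (map_poly (real_complex R) (line P x e)).[t] = 0 -> complex.Im t = 0.
Proof. by move=> [_ h]; rewrite map_line -evalp_lineE => /h. Qed.

Lemma dirderivn_top N P e x : homog N P ->
  evalp (dirderivn N e P) x = evalp P e *+ N`!.
Proof. by move=> hP; rewrite -coef_lineR coef_line_top. Qed.

(** The polynomial t |-> P(x + t e) is real-rooted with leading coefficient P(e) > 0 and no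
    nonnegative root, so all its coefficients are positive. *)
Lemma hyperbolic_pcone N P e x : homog N P -> hyperbolic P e ->
  (forall r : R, 0 <= r -> evalp P (x + r *: e) != 0) -> pcone P e N x.
Proof.
move=> hP hyp hx j jN; have [Pe _] := hyp.
have ctop : 0 < (line P x e)`_N by rewrite (coef_line_top _ _ hP).
have sz : size (line P x e) = N.+1.
  apply/eqP; rewrite eqn_leq size_line//= ltnNge; apply/negP => h.
  by rewrite nth_default ?ltxx in ctop.
rewrite dirderivn_gt0E; apply: real_rooted_coef_gt0; rewrite ?sz//.
- by move=> t; exact: hyperbolic_line.
- by rewrite lead_coefE sz.
- by move=> r /hx; rewrite horner_lineR.
Qed.

Lemma pcone_dirderivn_ge0 N P e x k : homog N P -> pcone_closed P e N x ->
  0 <= evalp (dirderivn k e P) x.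
Proof.
move=> hP cx; have [/cx//|Nk] := leqP k N.
by rewrite (dirderivn_over _ _ hP).
Qed.

Lemma pcone_sub N P e : pcone P e N `<=` pcone_closed P e N.
Proof. by move=> x cx j /cx /ltW. Qed.

Lemma pcone_gt0 N P e x (r : R) : homog N P -> pcone P e N x -> 0 <= r ->
  0 < evalp P (x + r *: e).
Proof.
move=> hP cx r0; apply: (@lt_le_trans _ _ (evalp P x)).
  exact: (cx 0%N).
apply: taylor_le => // k; exact/(pcone_dirderivn_ge0 _ hP)/pcone_sub.
Qed.

(** In the Taylor expansion along e all terms are nonnegative, and the top one is strictly positive
    because D_e^N P is the constant N! P(e). *)
Lemma pcone_closed_shift N P e x (r : R) : homog N P -> hyperbolic P e ->
  pcone_closed P e N x -> 0 < r -> pcone P e N (x + r *: e).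
Proof.
move=> hP [Pe _] cx r0 j jN; apply: (@taylor_gt0 _ _ (N - j)) => //.
  by move=> k; rewrite dirderivnD; exact: (pcone_dirderivn_ge0 _ hP).
by rewrite dirderivnD subnK// (dirderivn_top _ _ hP) pmulrn_lgt0 ?fact_gt0.
Qed.

Lemma pcone_scale N P e x (r : R) : homog N P -> pcone P e N x -> 0 < r ->
  pcone P e N (r *: x).
Proof.
move=> hP cx r0 j jN; rewrite (evalp_homog _ _ (homog_dirderivn j e hP)).
by rewrite mulr_gt0 ?exprn_gt0// cx.
Qed.

Lemma pcone_self N P e : homog N P -> hyperbolic P e -> pcone P e N e.
Proof.
move=> hP hyp; apply: hyperbolic_pcone => // r r0; have [Pe _] := hyp.
rewrite -[X in X + _]scale1r -scalerDl (evalp_homog _ _ hP).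
by rewrite mulf_neq0 ?gt_eqF// ?exprn_gt0//; lra.
Qed.

Lemma pcone_closed0 P e N x : pcone_closed P e N x -> 0 < evalp P x ->
  homog N P -> hyperbolic P e -> pcone P e N x.
Proof.
move=> cx Px hP hyp; apply: hyperbolic_pcone => // r r0; rewrite gt_eqF//.
apply: lt_le_trans Px _; apply: taylor_le => // k.
exact: (pcone_dirderivn_ge0 _ hP).
Qed.

Lemma pcone_open P e N : open (pcone P e N).
Proof.
elim: N => [|N IH].
  have -> : pcone P e 0 = evalp (dirderivn 0 e P) @^-1` [set r | 0 < r].
    by apply/seteqP; split=> [x /(_ 0%N (leqnn _))//|x h [|//] _].
  by apply: open_comp; [move=> x _; exact: evalp_continuous|exact: open_gt].
have -> : pcone P e N.+1 =
    pcone P e N `&` evalp (dirderivn N.+1 e P) @^-1` [set r | 0 < r].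
  apply/seteqP; split=> x /=.
    by move=> h; split=> [j /leqW|]; [exact: h|exact: (h N.+1)].
  by move=> [h1 h2] j; rewrite leq_eqVlt => /orP[/eqP->//|]; exact: h1.
apply: openI => //.
by apply: open_comp; [move=> x _; exact: evalp_continuous|exact: open_gt].
Qed.

Lemma pcone_closed_closed P e N : closed (pcone_closed P e N).
Proof.
have -> : pcone_closed P e N = \bigcap_(j in [set j | (j <= N)%N])
    (evalp (dirderivn j e P) @^-1` [set r | 0 <= r]) by [].
apply: closed_bigI => j _; apply: closed_comp; last exact: closed_ge.
by move=> x _; exact: evalp_continuous.
Qed.

Lemma line_continuous x y : continuous (fun r : R => x + r *: y).
Proof.
move=> r; apply: (@continuousD _ _ _ (cst x) (fun r : R => r *: y)).
  exact: cst_continuous.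
exact: scalel_continuous.
Qed.

Lemma pcone_connected N P e : homog N P -> hyperbolic P e ->
  connected (pcone P e N).
Proof.
move=> hP hyp.
pose seg x := (fun r : R => x + r *: (e - x)) @` `[0, 1]%classic.
have -> : pcone P e N = \bigcup_(x in pcone P e N) seg x.
  apply/seteqP; split=> x.
    move=> cx; exists x => //; exists 0; last by rewrite scale0r addr0.
    by rewrite /= in_itv/= lexx ler01.
  move=> [y cy [r /=]]; rewrite in_itv/= => /andP[r0 r1] <-.
  have -> : y + r *: (e - y) = (1 - r) *: y + r *: e.
    by rewrite scalerBr scalerBl scale1r addrA addrAC.
  move: r0 r1; rewrite le_eqVlt => /orP[/eqP<- _|r0].
    by rewrite subr0 scale1r scale0r addr0.
  rewrite le_eqVlt => /orP[/eqP->|r1].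
    by rewrite subrr scale0r scale1r add0r; exact: pcone_self.
  apply: pcone_closed_shift => //; apply: pcone_sub.
  by apply: pcone_scale => //; lra.
apply: bigcup_connected.
  exists e => x cx; exists 1; last by rewrite scale1r addrC subrK.
  by rewrite /= in_itv/= lexx ler01.
move=> x cx; apply: connected_continuous_connected.
  exact: segment_connected.
by apply: continuous_subspaceT => r; exact: line_continuous.
Qed.

(** The set [pcone P e N] is connected, being star-shaped about e, and it is relatively open and
    closed in {P > 0}: by [pcone_closed0] it has the same trace there as the closed set
    [pcone_closed P e N]. *)
Lemma open_coneE N P e : homog N P -> hyperbolic P e ->
  open_cone P e = pcone P e N.
Proof.
move=> hP hyp; apply/seteqP; split; last first.
  apply: connected_component_max; last exact: pcone_connected.
    exact: pcone_self.
  by move=> x /(_ 0%N); exact.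
move=> x [C [Ce CP Cc] Cx].
suff : C `&` pcone P e N = C by move=> /seteqP[_ /(_ _ Cx) []].
apply: Cc.
- by exists e; split=> //; exact: pcone_self.
- by exists (pcone P e N) => //; exact: pcone_open.
exists (pcone_closed P e N); first exact: pcone_closed_closed.
apply/seteqP; split=> y [Cy cy]; split=> //; first exact: pcone_sub.
by apply: pcone_closed0 => //; exact: CP.
Qed.

Lemma closed_coneE N P e : homog N P -> hyperbolic P e ->
  closed_cone P e = pcone_closed P e N.
Proof.
move=> hP hyp; rewrite /closed_cone (open_coneE hP hyp); apply/seteqP; split.
  rewrite [X in _ `<=` X](closure_id _).1; last exact: pcone_closed_closed.
  by apply: closureS; exact: pcone_sub.
move=> x cx B /= nB.
have : nbhs (0 : R) ((fun r : R => x + r *: e) @^-1` B).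
  by apply: line_continuous; rewrite scale0r addr0.
move=> /nbhs_ballP[delta /= d0 hd]; exists (x + (delta / 2) *: e).
have d2 : 0 < delta / 2 by rewrite divr_gt0.
split; first exact: pcone_closed_shift.
apply: hd; rewrite /ball/= sub0r normrN gtr0_norm// ltr_pdivrMr//; lra.
Qed.

(** Positive derivatives along e give P(a + r e) > 0 for r >= 0, which is the condition of
    [hyperbolic_stable]. *)
Lemma pcone_hyperbolic N P e a : homog N P -> hyperbolic P e ->
  pcone P e N a -> hyperbolic P a.
Proof.
move=> hP hyp ca; apply: (stable_hyperbolic hP).
  exact: (ca 0%N).
by apply: (hyperbolic_stable hP hyp) => r r0; rewrite gt_eqF// (pcone_gt0 hP ca).
Qed.

Lemma pcone_eq N P e a : homog N P -> hyperbolic P e ->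
  pcone P e N a -> pcone P a N = pcone P e N.
Proof.
move=> hP hyp ca; have hypa := pcone_hyperbolic hP hyp ca.
rewrite -(open_coneE hP hypa) -(open_coneE hP hyp); apply/esym.
by apply: same_connected_component; rewrite -/(open_cone P e) (open_coneE hP hyp).
Qed.

Lemma pcone_closed_eq N P e a : homog N P -> hyperbolic P e ->
  pcone P e N a -> pcone_closed P a N = pcone_closed P e N.
Proof.
move=> hP hyp ca; have hypa := pcone_hyperbolic hP hyp ca.
rewrite -(closed_coneE hP hypa) -(closed_coneE hP hyp) /closed_cone.
by rewrite (open_coneE hP hypa) (open_coneE hP hyp) (pcone_eq hP hyp ca).
Qed.

(** Convexity comes from a change of reference direction: described from y, the same closed cone
    contains x, and x + y is a shift of x along y. *)
Lemma pcone_closed_add N P e x y : homog N P -> hyperbolic P e ->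
  pcone_closed P e N x -> pcone P e N y -> pcone P e N (x + y).
Proof.
move=> hP hyp cx cy; have hypy := pcone_hyperbolic hP hyp cy.
rewrite -(pcone_eq hP hyp cy) -[y in x + y]scale1r.
by apply: pcone_closed_shift => //; rewrite (pcone_closed_eq hP hyp cy).
Qed.

End Cones.

(** * Derivatives in directions of the cone *)

Section DerivativesOnCones.
Context {R : realType} {d : nat}.
Local Notation C := (complex R).
Local Notation toC := (real_complex R).
Local Notation Im := (@complex.Im R).
Local Notation Re := (@complex.Re R).
Local Notation vC := (map_mx toC).
Local Notation ii := (Complex 0 1 : C).
Implicit Types (P : mpoly d R) (x y z w e a b : 'rV[R]_d) (L : set 'rV[R]_d).

(** Openness is asked along lines only, which is what arguments with one-variable polynomials
    consume. *)
Record open_convex_cone L : Prop := OpenConvexCone {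
  occ_add : forall x y, L x -> L y -> L (x + y);
  occ_scale : forall (r : R) x, 0 < r -> L x -> L (r *: x);
  occ_near : forall a x, L a -> exists2 delta : R, 0 < delta &
    forall r : R, `|r| < delta -> L (a + r *: x) }.

Lemma pcone_open_convex N P e : homog N P -> hyperbolic P e ->
  open_convex_cone (pcone P e N).
Proof.
move=> hP hyp; split.
- by move=> x y cx cy; apply: pcone_closed_add => //; exact: pcone_sub.
- by move=> r x r0 cx; exact: pcone_scale.
move=> a x ca.
have : nbhs (0 : R) ((fun r : R => a + r *: x) @^-1` pcone P e N).
  apply: line_continuous; rewrite scale0r addr0.
  by apply: open_nbhs_nbhs; split=> //; exact: pcone_open.
move=> /nbhs_ballP[delta /= d0 hd]; exists delta => // r rd.
by apply: hd; rewrite /ball/= sub0r normrN.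
Qed.

(* The closure of an open convex cone L, described by L + z `<=` L. *)
Definition recession L : set 'rV[R]_d := [set z | forall w, L w -> L (z + w)].

Lemma pcone_closed_recession N P e : homog N P -> hyperbolic P e ->
  pcone_closed P e N `<=` recession (pcone P e N).
Proof. by move=> hP hyp z cz w cw; exact: pcone_closed_add. Qed.

Section OnCone.
Variable L : set 'rV[R]_d.
Hypothesis HL : open_convex_cone L.

Lemma recession_sub : L `<=` recession L.
Proof. by move=> z Lz w Lw; exact: occ_add. Qed.

Lemma recession_scale (r : R) z : 0 <= r -> recession L z -> recession L (r *: z).
Proof.
rewrite le_eqVlt => /orP[/eqP<- _ w|r0 Lz w Lw]; first by rewrite scale0r add0r.
have -> : r *: z + w = r *: (z + r^-1 *: w).
  by rewrite scalerDr scalerA mulfV ?gt_eqF// scale1r.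
by apply: occ_scale => //; apply: Lz; apply: occ_scale => //; rewrite invr_gt0.
Qed.

Lemma recession_add x y : recession L x -> recession L y -> recession L (x + y).
Proof. by move=> Lx Ly w Lw; rewrite -addrA; apply: Lx; exact: Ly. Qed.

Definition hyperbolic_on P := forall a, L a -> hyperbolic P a.

Lemma meval_upper P x y (t : C) z : hyperbolic_on P ->
  L (y + Im t *: z) ->
  meval ((vC x + ii *: vC y + t *: vC z) 0) (map_mpoly toC P) != 0.
Proof.
move=> hyp /hyp[_ h]; apply/negP => /eqP q0.
suff /h/eqP : evalp_line P (x + Re t *: z) (y + Im t *: z) ii = 0.
  by rewrite oner_eq0.
rewrite evalp_lineE horner_line !vCD (vCZ (Re t)) (vCZ (Im t)).
have E : vC x + toC (Re t) *: vC z + ii *: (vC y + toC (Im t) *: vC z) =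
    vC x + ii *: vC y + t *: vC z.
  rewrite [ii *: (_ + _)]scalerDr [ii *: (_ *: _)]scalerA addrACA -scalerDl.
  by rewrite {3}[t]complexE complexiE.
by rewrite E.
Qed.

(** This is a Gauss-Lucas argument: t |-> P(x + i a + t b) is not constant and has all its roots
    below the real axis, so its logarithmic derivative at 0 is not zero. Positivity at a is the
    coefficient of degree 1 of P(a + t b). *)
Lemma hyperbolic_dirderiv N P b : homog N.+1 P -> hyperbolic_on P -> L b ->
  hyperbolic_on (dirderiv b P).
Proof.
move=> hP hyp Lb a La; apply: (stable_hyperbolic (homog_dirderiv b hP)).
  have := @hyperbolic_pcone R d N.+1 P b a hP (hyp _ Lb) _ 1%N isT; apply => r.
  rewrite le_eqVlt => /orP[/eqP<-|r0].
    by rewrite scale0r addr0 gt_eqF//; have [] := hyp _ La.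
  by rewrite gt_eqF//; have [] := hyp _ (occ_add HL La (occ_scale HL r0 Lb)).
move=> x; rewrite map_mpoly_ddir.
set q := map_mpoly toC P; pose f := line q (vC x + ii *: vC a) (vC b).
have hf t : 0 <= Im t -> f.[t] != 0.
  rewrite horner_line => t0; apply: meval_upper => //.
  move: t0; rewrite le_eqVlt => /orP[/eqP<-|t0].
    by rewrite scale0r addr0.
  by apply: occ_add => //; exact: occ_scale.
have sz : (1 < size f)%N.
  rewrite ltnNge; apply/negP => h.
  have := coef_line_top (vC x + ii *: vC a) (vC b) (homogC hP).
  rewrite nth_default ?meval_real; last exact: leq_trans h _.
  by move/esym/eqP; rewrite fmorph_eq0 gt_eqF//; have [] := hyp _ Lb.
have [_ /(_ sz)] := Im_logder hf.
rewrite deriv_line horner_line scale0r addr0.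
by apply: contraTneq => ->; rewrite mul0r ltxx.
Qed.

Definition mixed P (s : seq 'rV[R]_d) := foldl (fun Q a => dirderiv a Q) P s.

(** Unlike hyperbolicity, this property passes to derivatives along boundary directions of the cone,
    which may vanish identically. *)
Definition mixed_nonneg P := forall s w,
  (forall a, a \in s -> L a) -> L w -> 0 <= evalp (mixed P s) w.

Lemma mixedD P1 P2 s : mixed (P1 + P2) s = mixed P1 s + mixed P2 s.
Proof. by elim: s P1 P2 => //= a s IH P1 P2; rewrite dirderivD IH. Qed.

Lemma mixedZ (r : R) P s : mixed (r *: P) s = r *: mixed P s.
Proof. by elim: s P => //= a s IH P; rewrite dirderivZ IH. Qed.

Lemma mixed0 s : mixed 0 s = 0.
Proof. by have := mixedZ 0 0 s; rewrite !scale0r. Qed.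

Lemma hyperbolic_mixed_nonneg N P : homog N P -> hyperbolic_on P ->
  mixed_nonneg P.
Proof.
move=> hP hyp s; elim: s N P hP hyp => [|a s IH] N P hP hyp w hs Lw.
  by have [/ltW] := hyp _ Lw.
have La : L a by apply: hs; rewrite mem_head.
have hs' b : b \in s -> L b by move=> bs; apply: hs; rewrite in_cons bs orbT.
case: N hP => [|N] hP /=.
  by rewrite [dirderiv a P](ddir_homog0 a hP) mixed0 /evalp meval0.
exact: (IH N _ (homog_dirderiv a hP) (hyperbolic_dirderiv hP hyp La)).
Qed.

Lemma dirderivDl y1 y2 P : dirderiv (y1 + y2) P = dirderiv y1 P + dirderiv y2 P.
Proof. exact: ddirDl. Qed.

Lemma dirderivZl (r : R) y P : dirderiv (r *: y) P = r *: dirderiv y P.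
Proof. exact: ddirZl. Qed.

Lemma dirderivC y1 y2 P :
  dirderiv y1 (dirderiv y2 P) = dirderiv y2 (dirderiv y1 P).
Proof. exact: ddir_comm. Qed.

Lemma dirderivn_comm k y1 y2 P :
  dirderivn k y1 (dirderiv y2 P) = dirderiv y2 (dirderivn k y1 P).
Proof. by elim: k => //= k ->; rewrite dirderivC. Qed.

Lemma dirderivnC j k y1 y2 P :
  dirderivn j y1 (dirderivn k y2 P) = dirderivn k y2 (dirderivn j y1 P).
Proof. by elim: k => //= k IH; rewrite dirderivn_comm IH. Qed.

Lemma mixed_nonneg_dirderiv P z : mixed_nonneg P -> recession L z ->
  mixed_nonneg (dirderiv z P).
Proof.
move=> pP Lz s w hs Lw.
(* The direction z + r w lies in L for r > 0; the derivative along it is affine in r, and r tends to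
   0. *)
pose f : {poly R} := (evalp (mixed (dirderiv z P) s) w)%:P +
  (evalp (mixed (dirderiv w P) s) w) *: 'X.
have := @poly_ge0_limit _ f; rewrite !hornerE; apply => r r0.
have Lzr : L (z + r *: w) by apply: Lz; exact: occ_scale.
have := pP ((z + r *: w) :: s) w; rewrite /= dirderivDl dirderivZl mixedD mixedZ.
rewrite /f !hornerE /evalp mevalD mevalZ mulrC; apply => // a.
by rewrite in_cons => /orP[/eqP->//|]; exact: hs.
Qed.

Lemma mixed_nonneg_dirderivn k P z : mixed_nonneg P -> recession L z ->
  mixed_nonneg (dirderivn k z P).
Proof. by move=> pP Lz; elim: k => //= k IH; exact: mixed_nonneg_dirderiv. Qed.

Lemma mixed_nonneg_ge0 P w : L !=set0 -> mixed_nonneg P -> recession L w ->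
  0 <= evalp P w.
Proof.
move=> [b Lb] pP Lw; rewrite -[w in evalp P w]addr0 -[X in w + X](scale0r b).
rewrite -horner_lineR; apply: poly_ge0_limit => r r0.
rewrite horner_lineR; apply: (pP [::]) => //.
by apply: Lw; exact: occ_scale.
Qed.

Lemma mixed_nonneg_le P x y : L !=set0 -> mixed_nonneg P ->
  recession L x -> recession L y -> evalp P x <= evalp P (x + y).
Proof.
move=> L0 pP Lx Ly; rewrite -[y in x + y]scale1r.
apply: taylor_le => // k; apply: mixed_nonneg_ge0 => //.
exact: mixed_nonneg_dirderivn.
Qed.

(** P is monotone along the cone. For small r the points e + r (x - e) and e - r (x - e) lie in L
    and add up to 2 e, where P vanishes by homogeneity; so P vanishes near e on the line to x, hence
    on the whole line. *)
Lemma mixed_nonneg_eq0 N P e : homog N P -> mixed_nonneg P -> L e ->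
  evalp P e = 0 -> forall x, evalp P x = 0.
Proof.
move=> hP pP Le Pe x; have L0 : L !=set0 by exists e.
have [delta d0 hd] := occ_near HL (x - e) Le.
have f0 : line P e (x - e) = 0.
  apply: (poly_eq0_near d0) => r r0 r_lt; rewrite horner_lineR.
  have rd : `|r| < delta by rewrite gtr0_norm.
  apply/eqP; rewrite eq_le; apply/andP; split; last first.
    by apply: mixed_nonneg_ge0 => //; apply: recession_sub; exact: hd.
  have -> : 0 = evalp P ((e + r *: (x - e)) + (e + (- r) *: (x - e))).
    rewrite addrACA -scalerDl subrr scale0r addr0.
    by rewrite -mulr2n -scaler_nat (evalp_homog _ _ hP) Pe mulr0.
  by apply: mixed_nonneg_le => //; apply: recession_sub; apply: hd => //; rewrite normrN.
have := horner_lineR P e (x - e) 1.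
by rewrite f0 horner0 scale1r addrC subrK => <-.
Qed.

End OnCone.

Lemma evalp_eq0_dirderiv P a : (forall x, evalp P x = 0) ->
  forall x, evalp (dirderiv a P) x = 0.
Proof.
move=> P0 x; have l0 : line P x a = 0.
  by apply: poly_eq_fun => t; rewrite horner_lineR P0 horner0.
have := coef_lineR 1 P x a; rewrite l0 coef0 mul0rn => /esym; exact.
Qed.

Lemma evalp_eq0_dirderivn k P a : (forall x, evalp P x = 0) ->
  forall x, evalp (dirderivn k a P) x = 0.
Proof. by move=> P0; elim: k => //= k IH; exact: evalp_eq0_dirderiv. Qed.

(** For k >= 2 some k-th root has nonnegative imaginary part, and it cannot be real because its
    power is not. *)
Lemma exists_upper_root k (s : R) : (1 < k)%N -> s != 0 ->
  exists2 w : C, 0 < Im w & w ^+ k = toC s * ii.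
Proof.
move=> k1 s0; have k0 : (0 < k)%N by exact: leq_trans k1.
exists (k.-root (toC s * ii)); last exact: rootCK.
have h : 0 <= Im (k.-root (toC s * ii)).
  by have := Im_rootC_ge0 (toC s * ii) k1; rewrite -complexIm lecR.
rewrite lt_def h andbT; apply/eqP => i0.
have := rootCK k0 (toC s * ii); rewrite -(toC_Re i0) -(rmorphXn toC).
move/(congr1 Im); rewrite ImZ /= mulr1 => /esym/eqP; exact/negP.
Qed.

(* Near a zero of order k >= 2, the upper half-plane alone suffices for u / f to
   take values of every argument. *)
Lemma upper_to_lower_eq0 (f u : {poly R}) : f.[0] != 0 ->
  (forall t : C, 0 < Im t -> (map_poly toC f).[t] != 0 /\
     Im ((map_poly toC u).[t] / (map_poly toC f).[t]) <= 0) ->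
  u.[0] = 0 -> u^`().[0] = 0 -> u = 0.
Proof.
move=> f0 hIm u0 du0; apply/eqP/negPn/negP => un0.
have [k [w]] := multiplicity_XsubC u 0; rewrite un0 /= => w0 uE.
rewrite rootE in w0; rewrite subr0 in uE.
have k1 : (1 < k)%N.
  case: k uE => [|[|k]] uE //.
    by move: u0; rewrite uE expr0 mulr1 => /eqP; rewrite (negbTE w0).
  move: du0; rewrite uE expr1 derivM derivX !hornerE ?(mulr0, mulr1, add0r).
  by move=> /eqP; rewrite (negbTE w0).
(* Write u = w X^k. For t = r om, the quotient u / f is a positive multiple of om^k w(t) conj(f(t)),
   which is the polynomial G in r because f has real coefficients. The choice om^k = i s makes G(0)
   = i s^2, whose imaginary part has the forbidden sign. *)
pose s := w.[0] * f.[0].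
have s0 : s != 0 by rewrite mulf_neq0.
have [om om0 omk] := exists_upper_root k1 s0.
pose G : {poly C} := (om ^+ k)%:P * ((map_poly toC w) \Po (om *: 'X)) *
  ((map_poly toC f) \Po (conjc om *: 'X)).
have G0 : G.[0] = toC (s ^+ 2) * ii.
  rewrite /G !hornerM !horner_comp hornerC !hornerE omk.
  have e0 : 0 = toC 0 by [].
  rewrite [in X in _ * X * _]e0 [in X in _ * X]e0 !horner_map /=.
  rewrite -/toC -mulrA -(rmorphM toC) mulrAC -/s -(rmorphM toC).
  by rewrite expr2.
have ImG (r : R) : 0 < r -> Im G.[toC r] <= 0.
  move=> r0; have rom0 : 0 < Im (toC r * om) by rewrite ImZ mulr_gt0.
  have [fn0] := hIm _ rom0.
  have fconj : (map_poly toC f).[conjc om * toC r] =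
      conjc (map_poly toC f).[toC r * om].
    have -> : conjc om * toC r = conjc (toC r * om).
      by case: (om) => p q; apply/eqP; rewrite eq_complex /=; apply/andP; split; apply/eqP; ring.
    rewrite -[RHS]horner_map -map_poly_comp; congr (_.[_]).
    by apply: eq_map_poly => c /=; rewrite oppr0.
  have -> : G.[toC r] = om ^+ k * (map_poly toC w).[toC r * om] *
      conjc (map_poly toC f).[toC r * om].
    rewrite /G !hornerM !horner_comp hornerC !hornerZ !hornerX fconj.
    by rewrite [om * toC r]mulrC.
  set F := (map_poly toC f).[_] in fn0 *; set W := (map_poly toC w).[_].
  have -> : (map_poly toC u).[toC r * om] = W * (toC r ^+ k * om ^+ k).
    rewrite uE rmorphM rmorphXn /= map_polyX hornerM hornerXn.
    by rewrite exprMn.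
  have -> : W * (toC r ^+ k * om ^+ k) / F =
      toC (r ^+ k / (Normc.normc F) ^+ 2) * (om ^+ k * W * conjc F).
    have nF : toC (Normc.normc F ^+ 2) = F * conjc F.
      by rewrite -sqr_normc -(rmorphXn toC).
    have Fc0 : conjc F != 0 by rewrite conjc_eq0.
    have -> : toC (r ^+ k / Normc.normc F ^+ 2) = toC r ^+ k / (F * conjc F).
      by rewrite (rmorphM toC) -nF; congr (_ * _); [exact: rmorphXn|exact: fmorphV].
    by field; rewrite fn0 Fc0.
  rewrite ImZ pmulr_rle0// divr_gt0 ?exprn_gt0//.
  by rewrite lt_def nc_ge0 nc_eq0 fn0.
have s2 : 0 < s ^+ 2 by rewrite exprn_even_gt0.
pose g := G - (G.[0])%:P.
have g0 : g.[0] = 0 by rewrite !hornerE subrr.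
have [delta d0 hd] := poly_small g0 s2.
have d2 : 0 < delta / 2 by rewrite divr_gt0.
have /hd : `|delta / 2| < delta by rewrite gtr0_norm// ltr_pdivrMr//; lra.
have := nc_ge_Im (g.[toC (delta / 2)]).
rewrite hornerD hornerN hornerC G0 ImB ImZ /= mulr1.
have := ImG _ d2; set I := Im _ => I0.
rewrite ler_norml => /andP[h _] h2; lra.
Qed.

(** * Rigidity of logarithmic derivatives *)

Section Interlacing.
Variable L : set 'rV[R]_d.
Hypothesis HL : open_convex_cone L.

(* D_z P / P maps the upper half of the complexified line x + t a to the lower
   half-plane, so it is constant if its derivative vanishes at t = 0; its limit
   at infinity is 0. *)
Lemma log_derivative_rigid N P a z x : homog N P -> hyperbolic_on L P ->
  L a -> recession L z -> evalp P x != 0 ->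
  evalp P x * evalp (dirderiv a (dirderiv z P)) x =
    evalp (dirderiv a P) x * evalp (dirderiv z P) x ->
  evalp (dirderiv z P) a = 0.
Proof.
move=> hP hyp La Lz Px E.
case: N hP => [|N] hP.
  by rewrite [dirderiv z P](ddir_homog0 z hP) /evalp meval0.
pose f := line P x a; pose g := line (dirderiv z P) x a.
have l0 Q : (line Q x a).[0] = evalp Q x by rewrite horner_lineR scale0r addr0.
pose h := evalp (dirderiv z P) x / evalp P x.
pose u := g - h *: f.
have u0 : u = 0.
  apply: (@upper_to_lower_eq0 f u); rewrite ?l0//; last 2 first.
  - by rewrite /u hornerD hornerN hornerZ !l0 divfK// subrr.
  - rewrite /u derivB derivZ hornerD hornerN hornerZ !deriv_line !l0.
    apply/eqP; rewrite subr_eq0; apply/eqP/(mulfI Px); rewrite E /h.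
    by field.
  move=> t t0; set q := map_mpoly toC P.
  have cone (s : C) : 0 <= Im s -> L (Im t *: a + Im s *: z).
    move=> s0; rewrite addrC; apply: (recession_scale HL s0 Lz).
    exact: occ_scale.
  pose F := line q (vC x + t *: vC a) (vC z).
  have xt : vC x + t *: vC a = vC (x + Re t *: a) + ii *: vC (Im t *: a).
    rewrite vCD !vCZ {1}[t]complexE complexiE scalerDl addrA.
    by rewrite [ii *: (_ *: _)]scalerA.
  have F0 s : 0 <= Im s -> F.[s] != 0.
    move=> s0; rewrite /F horner_line xt; apply: (meval_upper (L := L)) => //.
    exact: cone.
  have FE : F.[0] = (map_poly toC f).[t].
    by rewrite map_line !horner_line scale0r addr0.
  have dFE : F^`().[0] = (map_poly toC g).[t].
    by rewrite deriv_line map_line !horner_line scale0r addr0 map_mpoly_ddir.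
  have ft := F0 0 (lexx _); rewrite FE in ft; split=> //.
  have [] := Im_logder F0; rewrite FE dFE => hle _.
  rewrite /u rmorphB /= map_polyZ /= hornerD hornerN hornerZ mulrBl mulfK//.
  by rewrite ImB /= subr0.
(* Now g = h f, where g has degree at most N while the coefficient of degree N + 1 of f is P(a) > 0.
   So h = 0 and g = 0, and D_z P(a) is the top coefficient of g. *)
have gN : g`_N.+1 = 0.
  by rewrite nth_default// /g (size_line _ _ (homog_dirderiv z hP)).
have h0 : h = 0.
  have := congr1 (fun v : {poly R} => v`_N.+1) u0.
  rewrite /u coefB coefZ gN coef0 sub0r (coef_line_top _ _ hP) => /eqP.
  rewrite oppr_eq0 mulf_eq0 => /orP[/eqP//|].
  by have [Pa _] := hyp _ La; rewrite -/(evalp P a) gt_eqF.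
rewrite /evalp -(coef_line_top x a (homog_dirderiv z hP)) -/g.
move: u0; rewrite /u h0 scale0r subr0 => ->; exact: coef0.
Qed.

End Interlacing.
End DerivativesOnCones.

(** * Derivative relaxations *)

Section Subspaces.
Context {R : realType} {d : nat}.

(** A subspace of maximal dimension among those inside W is all of W, since adjoining a vector of W
    cannot enlarge it. *)
Lemma vspace_of_pred (W : 'rV[R]_d -> Prop) : W 0 ->
  (forall (r : R) x y, W x -> W y -> W (r *: x + y)) ->
  exists V : {vspace 'rV[R]_d}, forall x, x \in V <-> W x.
Proof.
move=> W0 WZD.
pose Q k := `[< exists2 U : {vspace 'rV[R]_d}, \dim U = k & forall x, x \in U -> W x >].
have Q0 : exists k, Q k.
  exists 0%N; apply/asboolP; exists 0%VS; first exact: dimv0.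
  by move=> x; rewrite memv0 => /eqP->.
have Qb k : Q k -> (k <= \dim (fullv : {vspace 'rV[R]_d}))%N.
  by move=> /asboolP[U <- _]; apply: dimvS; exact: subvf.
case: (ex_maxnP Q0 Qb) => k /asboolP[U Uk UW] kmax.
exists U => x; split=> [/UW//|Wx].
have : (\dim (U + <[x]>) <= k)%N.
  apply: kmax; apply/asboolP; exists (U + <[x]>)%VS => // _ /memv_addP[u uU [_ /vlineP[r ->] ->]].
  by rewrite addrC; apply: WZD => //; exact: UW.
rewrite -Uk => dimle; have sub : (U <= U + <[x]>)%VS := addvSl _ _.
have := dimv_leqif_sup sub => -[_ /esym]; rewrite eqn_leq dimvS// dimle /= => h.
apply: (subvP h); apply: (subvP (addvSr _ _)); exact: memv_line.
Qed.

(** Without such a v, c would vanish on the kernel of A and so factor through A. *)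
Lemma descent_direction m (A : {linear 'rV[R]_d -> 'rV[R]_m}) (c : {scalar 'rV[R]_d}) :
  (forall y, exists x, A x = y) ->
  ~ (exists y : {scalar 'rV[R]_m}, forall x, c x = y (A x)) ->
  exists2 v, A v = 0 & c v < 0.
Proof.
move=> surjA nc; apply: contrapT => nv; apply: nc.
have ker x : A x = 0 -> c x = 0.
  move=> Ax; apply/eqP; rewrite eq_le; apply/andP; split; rewrite leNgt; apply/negP.
    move=> cx; apply: nv; exists (- x); first by rewrite linearN Ax oppr0.
    by rewrite linearN oppr_lt0.
  by move=> cx; apply: nv; exists x.
have [g gA] := choice surjA.
have lin : linear_for *%R (fun w => c (g w)).
  move=> r w1 w2; apply/eqP; rewrite -subr_eq0 -linearP -linearB; apply/eqP/ker.
  by rewrite linearB linearP !gA subrr.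
pose y : {scalar 'rV[R]_m} := HB.pack (fun w => c (g w))
  (GRing.isLinear.Build R _ _ _ (fun w => c (g w)) lin).
exists y => x; apply/eqP; rewrite -subr_eq0 -linearB; apply/eqP/ker.
by rewrite linearB gA subrr.
Qed.

End Subspaces.

Section DerivativeRelaxations.
Context {R : realType} {d : nat}.
Implicit Types (P : mpoly d R) (x y z w e a b : 'rV[R]_d) (L : set 'rV[R]_d).

Lemma recession_pcone N P e : homog N P -> hyperbolic P e ->
  recession (pcone P e N) = pcone_closed P e N.
Proof.
move=> hP hyp; apply/seteqP; split; last exact: pcone_closed_recession.
move=> z Lz j jN.
have l0 Q : evalp Q z = (line Q z e).[0].
  by rewrite (horner_lineR Q z e 0) scale0r addr0.
rewrite l0; apply: poly_ge0_limit => r r0; rewrite horner_lineR.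
by apply: ltW; apply: Lz => //; apply: pcone_scale => //; exact: pcone_self.
Qed.

Lemma hyperbolic_on_pcone N P e : homog N P -> hyperbolic P e ->
  hyperbolic_on (pcone P e N) P.
Proof. by move=> hP hyp a; exact: pcone_hyperbolic. Qed.

Lemma hyperbolic_dirderivn L N P b k : open_convex_cone L -> homog N P ->
  hyperbolic_on L P -> L b -> (k <= N)%N -> hyperbolic_on L (dirderivn k b P).
Proof.
move=> HL hP hyp Lb; elim: k => [//|k IH] kN.
have hk : homog (N - k).-1.+1 (dirderivn k b P).
  by rewrite prednK ?subn_gt0//; exact: homog_dirderivn.
exact: (hyperbolic_dirderiv HL hk (IH (ltnW kN)) Lb).
Qed.

Lemma pcone_closed_dirderivn N P e k : (k <= N)%N -> pcone_closed P e N `<=`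
  pcone_closed (dirderivn k e P) e (N - k).
Proof. by move=> kN x cx j jN; rewrite dirderivnD; apply: cx; lia. Qed.

Lemma dirderivn_swap_eq0 N P x y k : homog N P -> (k <= N)%N ->
  (evalp (dirderivn k y P) x == 0) = (evalp (dirderivn (N - k) x P) y == 0).
Proof.
by move=> hP kN; rewrite !dirderivn_eq0E (line_rev _ _ hP kN).
Qed.

Lemma evalp_eq0_dirderivn_le j k P a : (j <= k)%N ->
  (forall x, evalp (dirderivn j a P) x = 0) ->
  forall x, evalp (dirderivn k a P) x = 0.
Proof.
by move=> jk h x; rewrite -(subnK jk) -dirderivnD; exact: evalp_eq0_dirderivn.
Qed.

Lemma dirderivnDp k a P Q :
  dirderivn k a (P + Q) = dirderivn k a P + dirderivn k a Q.
Proof. by elim: k => //= k ->; rewrite dirderivD. Qed.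

Lemma dirderivnZp k a (r : R) P : dirderivn k a (r *: P) = r *: dirderivn k a P.
Proof. by elim: k => //= k ->; rewrite dirderivZ. Qed.

Lemma dirderivnZl k a (r : R) P : dirderivn k (r *: a) P = r ^+ k *: dirderivn k a P.
Proof.
elim: k => [|k IH]; first by rewrite expr0 scale1r.
by rewrite /= IH dirderivZl dirderivZ scalerA exprS.
Qed.

Lemma dirderivnS k a P : dirderivn k.+1 a P = dirderivn k a (dirderiv a P).
Proof. by rewrite /dirderivn iterSr. Qed.

(** Derivatives commute, so every term of the expansion containing u vanishes. It is applied to e' =
    r e + u. *)
Lemma dirderivn_shift (r : R) e u P k :
  (forall x, evalp (dirderiv u P) x = 0) -> forall x,
  evalp (dirderivn k (r *: e + u) P) x = r ^+ k * evalp (dirderivn k e P) x.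
Proof.
elim: k P => [|k IH] P uP x; first by rewrite expr0 mul1r.
rewrite !dirderivnS dirderivDl dirderivZl dirderivnDp dirderivnZp.
have -> : evalp (r *: dirderivn k (r *: e + u) (dirderiv e P) +
    dirderivn k (r *: e + u) (dirderiv u P)) x =
    r * evalp (dirderivn k (r *: e + u) (dirderiv e P)) x +
    evalp (dirderivn k (r *: e + u) (dirderiv u P)) x.
  by rewrite /evalp mevalD mevalZ.
rewrite (evalp_eq0_dirderivn _ _ uP) addr0 IH ?exprS ?mulrA// => y.
by rewrite dirderivC; exact: evalp_eq0_dirderiv.
Qed.

Lemma mixed_nonneg_dirderivn_le L P z z' w k : open_convex_cone L ->
  mixed_nonneg L P -> recession L z -> recession L z' -> L w ->
  evalp (dirderivn k z P) w <= evalp (dirderivn k (z + z') P) w.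
Proof.
move=> HL pP Lz Lz' Lw; elim: k P pP => [//|k IH] P pP.
rewrite !dirderivnS dirderivDl dirderivnDp.
have -> : forall Q1 Q2, evalp (Q1 + Q2) w = evalp Q1 w + evalp Q2 w.
  by move=> Q1 Q2; rewrite /evalp mevalD.
apply: le_trans (IH _ (mixed_nonneg_dirderiv HL pP Lz)) _.
rewrite lerDl; apply: (mixed_nonneg_ge0 HL); first by exists w.
  apply: (mixed_nonneg_dirderivn HL); last exact: recession_add.
  exact: (mixed_nonneg_dirderiv HL).
exact: recession_sub.
Qed.

Lemma dirderiv_eq0_line P z : (forall x, evalp (dirderiv z P) x = 0) ->
  forall r : R, evalp P (r *: z) = evalp P z.
Proof.
move=> P0.
have cst : line P 0 z = ((line P 0 z)`_0)%:P.
  apply/polyP => -[|k]; rewrite coefC//=; apply/eqP.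
  rewrite -dirderivn_eq0E dirderivnS; apply/eqP.
  exact: evalp_eq0_dirderivn.
have E (r : R) : evalp P (r *: z) = (line P 0 z)`_0.
  by rewrite -[r *: z]add0r -horner_lineR cst hornerC coefC.
by move=> r; rewrite E -[z in RHS]scale1r E.
Qed.

End DerivativeRelaxations.

(** * Faces of derivative relaxations *)

Section Faces.
Context {R : realType} {d : nat}.
Variables (n : nat) (p : mpoly d R) (e0 : 'rV[R]_d).
Hypothesis hp : homog n p.
Hypothesis hyp : hyperbolic p e0.
Implicit Types (x y z e u : 'rV[R]_d).
Local Notation L := (pcone p e0 n).

Let HL : open_convex_cone L := pcone_open_convex hp hyp.
Let hypL : hyperbolic_on L p := hyperbolic_on_pcone hp hyp.
Let pP : mixed_nonneg L p := hyperbolic_mixed_nonneg HL hp hypL.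

(** Reversing the line turns the hypothesis into D_z^(n - j) p(e) = 0 at an interior point, hence
    everywhere. *)
Lemma dirderivn_eq0_order e z l j : L e -> recession L z -> (j <= n)%N ->
  evalp (dirderivn j e p) z = 0 -> (n - j <= l)%N ->
  forall x, evalp (dirderivn l z p) x = 0.
Proof.
move=> Le Lz jn /eqP; rewrite (dirderivn_swap_eq0 _ _ hp jn) => /eqP h nl.
apply: (evalp_eq0_dirderivn_le nl).
apply: (mixed_nonneg_eq0 HL (homog_dirderivn _ _ hp) _ Le h).
exact: mixed_nonneg_dirderivn.
Qed.

(* z maximizes l over O; the last property expresses that l does not increase at
   (z + z') / 2. *)
Lemma maximal_order_point (O : set 'rV[R]_d) e : L e -> O !=set0 ->
  O `<=` recession L ->
  (forall x y, O x -> O y -> O (2^-1 *: (x + y))) ->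
  exists z l, [/\ O z, evalp (dirderivn l z p) e != 0,
    forall x, evalp (dirderivn l.+1 z p) x = 0 &
    forall z' x, O z' -> evalp (dirderiv z' (dirderivn l z p)) x = 0].
Proof.
move=> Le [z1 Oz1] OL Omid.
pose Q l := `[< exists2 z, O z & evalp (dirderivn l z p) e != 0 >].
have Q0 : exists l, Q l.
  exists 0%N; apply/asboolP; exists z1 => //.
  by rewrite gt_eqF//; have [] := hypL Le.
have Qb l : Q l -> (l <= n)%N.
  move=> /asboolP[z _]; apply: contraNT; rewrite -ltnNge => nl.
  by rewrite (dirderivn_over _ _ hp nl).
case: (ex_maxnP Q0 Qb) => l /asboolP[z Oz zl] lmax.
have top z' : O z' -> evalp (dirderivn l.+1 z' p) e = 0.
  move=> Oz'; apply/eqP/negPn/negP => h; suff /lmax : Q l.+1 by rewrite ltnn.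
  by apply/asboolP; exists z'.
have face z' x : O z' -> evalp (dirderiv z' (dirderivn l z p)) x = 0.
  move=> Oz'; have Lz := OL _ Oz; have Lz' := OL _ Oz'.
  have nn : mixed_nonneg L (dirderiv z' (dirderivn l z p)).
    by apply: mixed_nonneg_dirderiv => //; exact: mixed_nonneg_dirderivn.
  apply: (mixed_nonneg_eq0 HL (homog_dirderiv _ (homog_dirderivn _ _ hp)) nn Le).
  apply/eqP; rewrite eq_le (mixed_nonneg_ge0 HL)//; last 2 first.
  - by exists e.
  - exact: recession_sub.
  rewrite andbT.
  (* Maximality of l at the midpoint. Expanding the power of D_(z + z'), all terms are nonnegative
     at e, so the one with z' once and z l times vanishes too. *)
  have tot : evalp (dirderivn l.+1 (z + z') p) e = 0.
    have /eqP := top _ (Omid _ _ Oz Oz'); rewrite dirderivnZl /evalp mevalZ.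
    by rewrite mulf_eq0 expf_eq0/= invr_eq0 pnatr_eq0 /= => /eqP.
  have zP' := mixed_nonneg_dirderiv HL pP Lz'.
  rewrite -[leRHS]tot -dirderivn_comm.
  apply: le_trans (mixed_nonneg_dirderivn_le l HL zP' Lz Lz' Le) _.
  have evD Q1 Q2 : evalp (Q1 + Q2) e = evalp Q1 e + evalp Q2 e.
    by rewrite /evalp mevalD.
  rewrite dirderivnS dirderivDl dirderivnDp evD lerDr.
  apply: (mixed_nonneg_ge0 HL).
  - by exists e.
  - apply: (mixed_nonneg_dirderivn HL); last exact: recession_add.
    exact: (mixed_nonneg_dirderiv HL).
  - exact: recession_sub.
exists z, l; split=> // x; exact: face.
Qed.

Lemma hyperbolic_relaxation e k : L e -> (k <= n)%N ->
  hyperbolic (dirderivn k e p) e.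
Proof. by move=> Le kn; apply: (hyperbolic_dirderivn HL hp). Qed.

(** Described from e, the relaxed cone keeps only the inequalities of order at least k. *)
Lemma recession_relaxation e k : L e -> (k <= n)%N ->
  recession L `<=` recession (pcone (dirderivn k e p) e (n - k)).
Proof.
move=> Le kn; rewrite (recession_pcone hp hyp).
rewrite (recession_pcone (homog_dirderivn _ _ hp) (hyperbolic_relaxation Le kn)).
by rewrite -(pcone_closed_eq hp hyp Le); exact: pcone_closed_dirderivn.
Qed.

(* Tangent directions of the relaxation at z are governed by K = D_z^l p,
   whose derivatives along e and e' are proportional. *)
Lemma relaxation_direction e e' u z x (r : R) l i : L e -> L e' ->
  0 < r -> e' = r *: e + u -> recession L z ->
  evalp (dirderivn l z p) e != 0 ->
  (forall x, evalp (dirderivn l.+1 z p) x = 0) ->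
  (forall x, evalp (dirderiv u (dirderivn l z p)) x = 0) ->
  (i <= n)%N ->
  pcone (dirderivn i e' p) e' (n - i) x ->
  exists2 s : R, 0 < s & pcone (dirderivn i e p) e (n - i) (z + s *: x).
Proof.
move=> Le Le' r0 e'E Lz zl zl1 uK le_in cx.
set K := dirderivn l z p in zl uK.
have ln : (l <= n)%N.
  by rewrite leqNgt; apply: contraNN zl => nl; rewrite (dirderivn_over _ _ hp nl).
have hK : homog (n - l) K := homog_dirderivn _ _ hp.
have KP : mixed_nonneg L K := mixed_nonneg_dirderivn HL _ pP Lz.
have Ke' : evalp K e' != 0.
  by apply: contraNneq zl => /(mixed_nonneg_eq0 HL hK KP Le') ->.
(* Along e' instead of e, this is D_z^l of D_e'^j p at a point x interior to the cone of D_e'^j p,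
   so it is nonnegative. If it were 0 it would vanish identically, and so would D_e'^(n - l) K = (n
   - l)! K(e'). *)
have Kpos j : (i <= j)%N -> (j <= n - l)%N -> 0 < evalp (dirderivn j e K) x.
  move=> ij jl; have jn : (j <= n)%N by lia.
  rewrite -(pmulr_rgt0 _ (exprn_gt0 j r0)) -(dirderivn_shift _ _ _ uK) -e'E.
  have hj : homog (n - j) (dirderivn j e' p) := homog_dirderivn _ _ hp.
  have hypj := hyperbolic_relaxation Le' jn.
  have HM := pcone_open_convex hj hypj.
  set M := pcone _ _ _ in HM.
  have Mx : M x.
    move=> q qj; rewrite dirderivnD; have := cx (q + (j - i))%N.
    by rewrite dirderivnD -addnA subnK//; apply; lia.
  have MP := hyperbolic_mixed_nonneg HM hj (hyperbolic_on_pcone hj hypj).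
  have Mz : recession M z := recession_relaxation Le' jn Lz.
  rewrite dirderivnC lt_def (mixed_nonneg_ge0 HM)//; last 3 first.
  - by exists x.
  - exact: mixed_nonneg_dirderivn.
  - exact: recession_sub.
  rewrite andbT; apply/negP => /eqP h0.
  have := mixed_nonneg_eq0 HM (homog_dirderivn _ _ hj)
    (mixed_nonneg_dirderivn HM _ MP Mz) Mx h0.
  rewrite -dirderivnC => /(evalp_eq0_dirderivn_le jl)/(_ e')/eqP.
  by rewrite (dirderivn_top _ _ hK) mulrn_eq0 eqn0Ngt fact_gt0 (negbTE Ke').
have step j : (j < n.+1)%N -> exists2 delta : R, 0 < delta & forall s : R,
    `|s| < delta -> (i <= j)%N -> 0 < s -> 0 < evalp (dirderivn j e p) (z + s *: x).
  rewrite ltnS => jn; have [ij|ji] := leqP i j; last by exists 1.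
  pose f := line (dirderivn j e p) z x.
  have hj : homog (n - j) (dirderivn j e p) := homog_dirderivn _ _ hp.
  suff [mm f0 fm] : exists2 mm, (forall k, (k < mm)%N -> f`_k = 0) & 0 < f`_mm.
    have [delta d0 hd] := poly_gt0_right f0 fm; exists delta => // s sd _ s0.
    by rewrite -horner_lineR; apply: hd => //; rewrite -[s]gtr0_norm.
  (* For j > n - l the value at z itself is positive: were it 0, D_z^l p would vanish
     identically. *)
  have [jl|lj] := leqP j (n - l)%N; last first.
    exists 0%N => //; rewrite -dirderivn_gt0E lt_def.
    have cz : pcone_closed p e n z.
      by rewrite (pcone_closed_eq hp hyp Le) -(recession_pcone hp hyp).
    rewrite [X in _ && X](cz j jn) andbT; apply: contraNneq zl => h.
    by rewrite /K (@dirderivn_eq0_order e z l j)//; lia.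
  have fE k : (k <= n - j)%N -> f`_k = (line (dirderivn j e p) x z)`_(n - j - k).
    by move=> kn; rewrite /f (line_rev _ _ hj kn).
  (* After reversal the coefficient of index k is a derivative along z of order n - j - k. It
     vanishes as long as this order exceeds l, and at order l it is positive by [Kpos]. *)
  exists (n - l - j)%N => [k kl|].
    rewrite fE; last by lia.
    apply/eqP; rewrite -dirderivn_eq0E dirderivnC; apply/eqP.
    apply: evalp_eq0_dirderivn; apply: (evalp_eq0_dirderivn_le _ zl1); lia.
  rewrite fE; last by lia.
  have -> : (n - j - (n - l - j))%N = l by lia.
  by rewrite -dirderivn_gt0E dirderivnC; exact: Kpos.
have [delta d0 hd] := common_delta step.
exists (delta / 2) => [|j jn]; first by rewrite divr_gt0.
rewrite dirderivnD; apply: hd; rewrite ?divr_gt0 ?leq_addl//; first by lia.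
by rewrite gtr0_norm ?divr_gt0// ltr_pdivrMr//; lra.
Qed.

(** Descending induction on the order. A point where D_e^t p does not vanish while D_e^(t + 1) p
    vanishes on the segment meets the condition of [log_derivative_rigid] with both sides 0; the
    conclusion contradicts D_z p(e) != 0. *)
Lemma segment_descent e z y i : L e -> recession L z ->
  evalp (dirderiv z p) e != 0 -> (i < n)%N ->
  (forall s : R, 0 <= s <= 1 ->
    evalp (dirderivn i e p) ((1 - s) *: z + s *: y) = 0) ->
  forall j s, (j <= i)%N -> 0 <= s <= 1 ->
    evalp (dirderivn j e p) ((1 - s) *: z + s *: y) = 0.
Proof.
move=> Le Lz zp lt_in hi j s ji; move: s.
rewrite -(subKn ji); elim: (i - j)%N => [|k IH] s s01.
  by rewrite subn0; exact: hi.
have [ik|ki] := leqP i k.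
  by have := IH s s01; rewrite (eqP ik : (i - k = 0)%N) subnS (eqP ik : (i - k = 0)%N).
set t := (i - k.+1)%N; have tE : (i - k)%N = t.+1 by rewrite /t subnSK.
rewrite tE in IH; set P := dirderivn t e p.
have tn : (t.+1 < n)%N by rewrite /t; lia.
have hP : homog (n - t) P := homog_dirderivn _ _ hp.
have hypP : hyperbolic_on L P by apply: (hyperbolic_dirderivn HL hp) => //; lia.
apply/eqP/negPn/negP => Px.
set x := (_ + _) in Px.
have := log_derivative_rigid HL hP hypP Le Lz Px.
have -> : evalp (dirderiv e P) x = 0 by exact: IH.
rewrite mul0r dirderivC.
(* For r > 0 the point x + r z is a positive multiple of another point of the segment, so D_e P
   vanishes there by homogeneity. *)
have seg0 : line (dirderiv e P) x z = 0.
  apply: (@poly_eq0_near R _ 1) => // r r0 _; rewrite horner_lineR.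
  have r1 : 0 < 1 + r by lra.
  move/andP: s01 => [s0 s1].
  have -> : x + r *: z = (1 + r) *: ((1 - s / (1 + r)) *: z + (s / (1 + r)) *: y).
    rewrite [RHS]scalerDr !scalerA mulrCA divff ?gt_eqF// mulr1.
    rewrite /x addrAC -scalerDl; congr (_ *: _ + _).
    by field; rewrite gt_eqF.
  rewrite (evalp_homog _ _ (homog_dirderiv _ hP)) IH ?mulr0//.
  by rewrite divr_ge0 ?(ltW r1)//= ler_pdivrMr// mul1r; lra.
have -> : evalp (dirderiv z (dirderiv e P)) x = 0.
  by have := coef_lineR 1 (dirderiv e P) x z; rewrite seg0 coef0 mul0rn => /esym.
rewrite mulr0 => /(_ erefl); rewrite /P -dirderivn_comm => h.
have hz : homog n.-1 (dirderiv z p) := homog_dirderiv _ hp.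
have zP : mixed_nonneg L (dirderiv z p) := mixed_nonneg_dirderiv HL pP Lz.
have := mixed_nonneg_eq0 HL (homog_dirderivn _ _ hz)
  (mixed_nonneg_dirderivn HL _ zP (recession_sub HL Le)) Le h.
have tn1 : (t <= n.-1)%N by lia.
move=> /(evalp_eq0_dirderivn_le tn1)/(_ e)/eqP.
by rewrite (dirderivn_top _ _ hz) mulrn_eq0 eqn0Ngt fact_gt0 (negbTE zp).
Qed.

End Faces.

(** * Optimal solutions *)

Section Optimality.
Context {R : realType} {d m : nat}.
Variables (A : {linear 'rV[R]_d -> 'rV[R]_m}) (b : 'rV[R]_m) (c : {scalar 'rV[R]_d}).
Hypothesis desc : exists2 v, A v = 0 & c v < 0.
Implicit Types (K L : set 'rV[R]_d) (x y : 'rV[R]_d).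

Lemma opt_not_interior K L x : open_convex_cone L -> L `<=` K ->
  Opt A b c K x -> ~ L x.
Proof.
move=> HL LK [[Ax Kx] xmin] Lx; have [v Av cv] := desc.
have [delta d0 hd] := occ_near HL v Lx.
have d2 : 0 < delta / 2 by rewrite divr_gt0.
have := xmin (x + (delta / 2) *: v); rewrite linearD linearZ /=.
have : delta / 2 * c v < 0 by rewrite pmulr_rlt0.
move=> h /(_ _); rewrite leNgt gtrDl h => H.
suff : false by []; apply: H; split; first by rewrite linearD linearZ /= Av scaler0 addr0.
by apply: LK; apply: hd; rewrite gtr0_norm// ltr_pdivrMr//; lra.
Qed.

Lemma opt_evalp_eq0 N (P : mpoly d R) e x : homog N P -> hyperbolic P e ->
  Opt A b c (recession (pcone P e N)) x -> evalp P x = 0.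
Proof.
move=> hP hyp Ox; have [[_ Kx] _] := Ox.
rewrite (recession_pcone hP hyp) in Kx.
apply/eqP; rewrite eq_le [X in _ && X](Kx 0%N)// andbT leNgt; apply/negP => Px.
have HL := pcone_open_convex hP hyp.
apply: (opt_not_interior HL (recession_sub HL) Ox).
exact: pcone_closed0.
Qed.

Lemma opt_segment L x y (s : R) : open_convex_cone L ->
  Opt A b c (recession L) x -> Opt A b c (recession L) y -> 0 <= s <= 1 ->
  Opt A b c (recession L) ((1 - s) *: x + s *: y).
Proof.
move=> HL [[Ax Lx] xmin] [[Ay Ly] ymin] /andP[s0 s1].
have cxy : c y = c x by apply/eqP; rewrite eq_le xmin// ymin.
have cs : c ((1 - s) *: x + s *: y) = c x.
  by rewrite linearD !linearZ /= cxy -mulrDl subrK mul1r.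
split; last by move=> w /xmin; rewrite cs.
split; first by rewrite linearD !linearZ /= Ax Ay -scalerDl subrK scale1r.
by apply: recession_add; apply: recession_scale => //; lra.
Qed.

End Optimality.

(** * Invariance of the core along the affine hull *)

Unset Implicit Arguments.

Theorem theorem6 (R : realType) (d m n : nat)
    (p : mpoly d R) (e0 : 'rV[R]_d)
    (A : {linear 'rV[R]_d -> 'rV[R]_m}) (b : 'rV[R]_m)
    (c : {scalar 'rV[R]_d}) (i : nat) (e : 'rV[R]_d)
    (homp : is_homogeneous n p)
    (hypp : hyperbolic p e0)
    (reg : regular_cone (closed_cone p e0))
    (surjA : forall y : 'rV[R]_m, exists x : 'rV[R]_d, A x = y)
    (b_neq0 : b <> 0)
    (c_notin : ~ exists y : {scalar 'rV[R]_m}, forall x : 'rV[R]_d, c x = y (A x))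
    (lt_in : (i < n)%N)
    (coree : Core p e0 A b c i e) :
  affine_hull ([set e] `|` Opt A b c (closed_cone p e0)) `&` open_cone p e0
    `<=` Core p e0 A b c i.
Proof.
have hp : homog n p := homp.
have desc := descent_direction surjA c_notin.
have HL := pcone_open_convex hp hypp.
have closedE : closed_cone p e0 = recession (pcone p e0 n).
  by rewrite (closed_coneE hp hypp) (recession_pcone hp hypp).
set L := pcone p e0 n in HL closedE.
have le_in : (i <= n)%N := ltnW lt_in.
have relE a : L a -> closed_cone (dirderivn i a p) a =
    recession (pcone (dirderivn i a p) a (n - i)).
  move=> La; have ha : homog (n - i) (dirderivn i a p) := homog_dirderivn _ _ hp.
  have hypa := hyperbolic_relaxation hp hypp La le_in.
  by rewrite (closed_coneE ha hypa) (recession_pcone ha hypa).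
rewrite closedE (open_coneE hp hypp) -/L.
have [[Le Ae _] OptE] := coree.
rewrite (open_coneE hp hypp) -/L in Le.
rewrite closedE (relE _ Le) in OptE.
set O := Opt A b c (recession L) in OptE *.
move=> e' [hull Le'].
have O0 : O !=set0.
  by case: coree => -[_ _]; rewrite (relE _ Le) OptE.
have OL : O `<=` recession L by move=> x [[]].
have Omid x y : O x -> O y -> O (2^-1 *: (x + y)).
  move=> Ox Oy; have -> : 2^-1 *: (x + y) = (1 - 2^-1) *: x + 2^-1 *: y.
    by rewrite scalerDr; congr (_ *: _ + _); lra.
  by apply: opt_segment => //; apply/andP; split; lra.
have [z [l [Oz zl zl1 face]]] := maximal_order_point hp hypp Le O0 OL Omid.
have [[Az Lz] zmin] := Oz.
have cO x : O x -> c x = c z.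
  by move=> [fx xmin]; apply/eqP; rewrite eq_le xmin// zmin.
have above a : L a -> A a = b -> c z < c a.
  move=> La Aa; have fa : feasible A b (recession L) a.
    by split; [exact: Aa|exact: recession_sub].
  rewrite lt_def zmin// andbT; apply/negP => /eqP ca.
  apply: (opt_not_interior (b := b) desc HL (recession_sub HL) _ La).
  by split=> // y /zmin; rewrite ca.
have g0 : 0 < c e - c z by rewrite subr_gt0 above.
set gam := c e - c z in g0.
(* W is a linear space built to contain z' - e for every z' in Opt: there c takes the value - gam,
   so the corrected vector is z' itself, along which D_z^l p has zero derivative. *)
pose W w := A w = 0 /\ forall x,
  evalp (dirderiv (w - (c w / gam) *: e) (dirderivn l z p)) x = 0.
have [||V VW] := @vspace_of_pred R d W.
- split=> [|x]; first exact: linear0.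
  by rewrite linear0 mul0r scale0r subr0 -(scale0r e) dirderivZl scale0r /evalp meval0.
- move=> r x y [Ax Wx] [Ay Wy]; split=> [|w].
    by rewrite linearP Ax Ay scaler0 addr0.
  have -> : r *: x + y - (c (r *: x + y) / gam) *: e =
      r *: (x - (c x / gam) *: e) + (y - (c y / gam) *: e).
    rewrite linearP /= mulrDl scalerDl -mulrA scalerBr scalerA.
    by rewrite opprD addrACA.
  rewrite dirderivDl dirderivZl.
  have evDZ Q1 Q2 : evalp (r *: Q1 + Q2) w = r * evalp Q1 w + evalp Q2 w.
    by rewrite /evalp mevalD mevalZ.
  by rewrite evDZ Wx Wy mulr0 addr0.
(* The affine space e + V contains e and Opt, hence e'. *)
have [Ae'0 ue'] : W (e' - e).
  apply/VW; have := hull [set x | x - e \in V]; apply; split.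
    by exists e, V.
  move=> x [->|Ox] /=; first by rewrite subrr; exact: mem0v.
  apply/VW; have [[Ax _] _] := Ox; split=> [|w].
    by rewrite linearB /= Ax Ae subrr.
  rewrite linearB /= (cO _ Ox).
  have -> : (c z - c e) / gam = -1 by rewrite -opprB mulNr divff// gt_eqF.
  by rewrite scaleN1r opprK subrK; exact: face.
have Ae' : A e' = b.
  by have := Ae'0; rewrite linearB /= Ae => /eqP; rewrite subr_eq0 => /eqP.
set u := _ - _ *: e in ue'.
(* This is (c e' - c z) / (c e - c z), positive because both e and e' are interior feasible points
   and so cost more than z. *)
pose lam := 1 + c (e' - e) / gam.
have e'E : e' = lam *: e + u.
  by rewrite /u scalerDl scale1r addrAC addrA subrK addrC subrK.
have lam0 : 0 < lam.
  rewrite /lam linearB /= -(pmulr_rgt0 _ g0) mulrDr mulr1 mulrCA divff ?gt_eqF//.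
  by rewrite mulr1 /gam; have := above _ Le' Ae'; lra.
set Le'i := pcone (dirderivn i e' p) e' (n - i) in relE.
have he' : homog (n - i) (dirderivn i e' p) := homog_dirderivn _ _ hp.
have hype' := hyperbolic_relaxation hp hypp Le' le_in.
have HL' : open_convex_cone Le'i := pcone_open_convex he' hype'.
have LL' : recession L `<=` recession Le'i.
  exact: (recession_relaxation hp hypp Le' le_in).
have Le'i_e' : Le'i e' by exact: pcone_self.
(* A cheaper x is first moved into the interior towards e'. Then [relaxation_direction] puts z + s
   x' into the relaxed cone of e, and division by 1 + s restores A = b at a cost below c z, against
   the optimality of z for e. *)
have zopt' x : feasible A b (recession Le'i) x -> c z <= c x.
  move=> [Ax Lx]; rewrite leNgt; apply/negP => xz.
  have ce' := above _ Le' Ae'.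
  (* With this step the cost of x' is halfway between c x and c z. *)
  pose ep := (c z - c x) / (2 * (c e' - c x)).
  have D0 : 0 < 2 * (c e' - c x) by lra.
  have ep0 : 0 < ep by rewrite divr_gt0//; lra.
  have epD : ep * (2 * (c e' - c x)) = c z - c x by rewrite divfK// gt_eqF.
  have ep1 : ep < 1 by rewrite ltr_pdivrMr//; lra.
  clearbody ep.
  pose x' := (1 - ep) *: x + ep *: e'.
  have cx' : c x' < c z.
    rewrite /x' linearD !linearZ /=.
    have -> : (1 - ep) * c x + ep * c e' = c x + ep * (2 * (c e' - c x)) / 2.
      by field.
    by rewrite epD; lra.
  have Ax' : A x' = b.
    by rewrite /x' linearD !linearZ /= Ax Ae' -scalerDl subrK scale1r.
  have Lx' : Le'i x'.
    have e1 : 0 <= 1 - ep by lra.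
    exact: (recession_scale HL' e1 Lx (occ_scale HL' ep0 Le'i_e')).
  have [s s0 ys] := relaxation_direction hp hypp Le Le' lam0 e'E Lz zl zl1 ue' le_in Lx'.
  have : O z := Oz; rewrite -OptE => -[_ zmine].
  have s1 : 0 < 1 + s by lra.
  have := zmine ((1 + s)^-1 *: (z + s *: x')).
  rewrite leNgt linearZ /= => /(_ _)/negP; apply; last first.
    rewrite mulrC ltr_pdivrMr// linearD linearZ /=.
    have : s * c x' < s * c z by rewrite ltr_pM2l.
    by lra.
  have hype := hyperbolic_relaxation hp hypp Le le_in.
  have he : homog (n - i) (dirderivn i e p) := homog_dirderivn _ _ hp.
  split.
    rewrite linearZ /= linearD linearZ /= Az Ax'.
    have -> : b + s *: b = (1 + s) *: b by rewrite scalerDl scale1r.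
    by rewrite scalerA mulVf ?gt_eqF// scale1r.
  have HLe := pcone_open_convex he hype.
  apply: (recession_sub HLe); apply: (occ_scale HLe) => //.
  by rewrite invr_gt0.
have OO' : O `<=` Opt A b c (recession Le'i).
  move=> x Ox; have [[Ax Lx] _] := Ox; split; first by split=> //; exact: LL'.
  by move=> y /zopt'; rewrite (cO _ Ox).
have Oz' := OO' _ Oz.
(* Otherwise D_z p vanishes identically, all D_e0^j p are constant along the line through 0 and z,
   and this line lies in the cone. Regularity gives z = 0, against A z = b. *)
have zp : evalp (dirderiv z p) e' != 0.
  apply/negP => /eqP h.
  have zp0 : forall x, evalp (dirderiv z p) x = 0.
    apply: (mixed_nonneg_eq0 HL (homog_dirderiv z hp) _ Le' h).
    apply: (mixed_nonneg_dirderiv HL) => //.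
    exact: (hyperbolic_mixed_nonneg HL hp (hyperbolic_on_pcone hp hypp)).
  have z0 : <[z]>%VS = 0%VS.
    apply: reg.2 => _ /= /vlineP[r ->]; rewrite (closed_coneE hp hypp) => j jn.
    rewrite dirderiv_eq0_line.
      have : recession L z := Lz; rewrite (recession_pcone hp hypp); exact.
    by move=> x; rewrite -dirderivn_comm; exact: evalp_eq0_dirderivn.
  apply: b_neq0; rewrite -Az.
  have : z \in <[z]>%VS := memv_line z.
  by rewrite z0 memv0 => /eqP->; rewrite linear0.
have O'O : Opt A b c (recession Le'i) `<=` O.
  move=> y Oy; have [[Ay Ly] ymin] := Oy.
  have cy : c y = c z.
    by apply/eqP; rewrite eq_le zopt'// andbT; apply: ymin; case: Oz'.
  split; last by move=> w /zmin; rewrite cy.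
  split=> //; rewrite (recession_pcone hp hypp) -(pcone_closed_eq hp hypp Le').
  move=> j jn.
  (* The segment consists of optimal points for e', which are never interior. At y this settles the
     orders up to i through [segment_descent]; the higher orders are inequalities of the relaxed
     cone. *)
  have seg (s : R) : 0 <= s <= 1 ->
      evalp (dirderivn i e' p) ((1 - s) *: z + s *: y) = 0.
    by move=> s01; apply: (opt_evalp_eq0 desc he' hype'); exact: (opt_segment HL' Oz' Oy).
  have [ji|ij] := leqP j i.
    have := segment_descent hp hypp Le' Lz zp lt_in seg ji (s := 1).
    by rewrite subrr scale0r scale1r add0r lexx ler01 => ->.
  move: Ly; rewrite (recession_pcone he' hype') => /(_ (j - i)%N).
  by rewrite dirderivnD subnK ?(ltnW ij)//; apply; lia.
have E : Opt A b c (closed_cone (dirderivn i e' p) e') = O.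
  by rewrite (relE _ Le'); apply/seteqP.
split; last by rewrite E closedE.
by split=> //; rewrite ?E// (open_coneE hp hypp).
Qed.
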